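(* Let $r\in\mathbb{R}$, let $\lambda=(\lambda_1,\ldots,\lambda_t)$ be a partition of $n$ and let $D=\mathrm{diag}(d_1,d_2,\ldots,d_n)\in T$. Set $I_\lambda=\{1,2,\ldots,n\}\setminus\{\lambda_1,\lambda_1+\lambda_2,\ldots,\sum_i\lambda_i=n\}$ and define $$H_{\lambda,D}=\bigcap_{i\in I_\lambda}H_{\alpha_i+\mathrm{val}(d_{i+1})-r}\subset\mathcal{A},$$ where $\alpha_i=e_i-e_{i+1}$. Let $\mathcal{F}$ be any maximal $r$-facet in $H_{\lambda,D}$ (i.e. an $r$-facet of maximal dimension among those contained in $H_{\lambda,D}$). Then $X=J_\lambda D$ lies in $\mathfrak{g}_{\mathcal F}$. Setting $v$ to be the image of $X$ in $V_{\mathcal F}$, we have $(\mathcal{F},v)\in I_r^d$ and $\mathcal{O}(\mathcal{F},v)=\mathrm{Ad}(G)X$.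
   Context: Field and group. $k$ is a non-Archimedean local field with integer ring $\mathcal{R}$, maximal ideal $\mathcal{P}$, normalized valuation $\mathrm{val}$, and finite residue field $\mathfrak{f}$ of characteristic $p_{\mathfrak f}>3(n-1)$; $n\ge2$. $G=\mathrm{SL}_n(k)$, $\mathfrak{g}=\mathfrak{sl}_n(k)$, $\mathbb{T}$ is the diagonal torus, $T=\mathbb{T}(k)$, $\mathfrak{t}$ its Lie algebra over $k$. $J_\lambda$ is the upper triangular nilpotent matrix in Jordan normal form with blocks of sizes the parts of $\lambda$ in decreasing order. Filtrations. $\mathcal{B}(G)$ is the Bruhat-Tits building and $\mathcal{A}\subset\mathcal{B}(G)$ the apartment of $\mathbb{T}$, identified with $X_*(\mathbb{T})\otimes\mathbb{R}=\{x\in\mathbb{R}^n:\sum_i x_i=0\}$, with coordinate functions $e_i$. Roots: $\Phi=\{e_i-e_j:i\ne j\}$, with root space of $e_i-e_j$ the matrices supported at entry $(i,j)$. Affine roots: $\Psi=\{\phi+m:\phi\in\Phi,m\in\mathbb{Z}\}$, with $(\phi+m)(x)=\phi(x)+m$; $\mathfrak{g}_{\phi+m}$ is the set of elements of the root space $\mathfrak{g}_\phi$ with entries in $\mathcal{P}^m$. For $x\in\mathcal{A}$, $r\in\mathbb{R}$: $\mathfrak{t}_r=\{H\in\mathfrak{t}:\mathrm{val}(d\chi(H))\ge r\ \forall\chi\in X^*(\mathbb{T})\}$, $\mathfrak{g}_{x,r}=\mathfrak{t}_r\oplus\sum_{\psi(x)\ge r}\mathfrak{g}_\psi$, and $\mathfrak{g}_{x,r+}$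 is defined with strict inequalities. These extend to $x\in\mathcal{B}(G)$ by $\mathfrak{g}_{gx,r}=\mathrm{Ad}(g)\mathfrak{g}_{x,r}$. $V_{x,r}=\mathfrak{g}_{x,r}/\mathfrak{g}_{x,r+}$, an $\mathfrak{f}$-vector space. Facets. For $\psi\in\Psi$, $H_{\psi-r}=\{x\in\mathcal{A}:\psi(x)=r\}$. For a finite subset $\Sigma\subseteq\Psi$, let $H_\Sigma=\bigcap_{\psi\in\Sigma}H_{\psi-r}$ ($=\mathcal{A}$ if $\Sigma=\emptyset$). An $r$-facet of $\mathcal{A}$ is a connected component of $H_\Sigma\setminus\bigcup_{\psi\in\Psi\setminus\Sigma}H_{\psi-r}$ for some $\Sigma$; its dimension is that of the smallest affine subspace of $\mathcal{A}$ containing it. The spaces $\mathfrak{g}_{x,r}$, $\mathfrak{g}_{x,r+}$ are constant for $x$ in an $r$-facet $\mathcal{F}$; write $\mathfrak{g}_{\mathcal F}=\mathfrak{g}_{x,r}$, $V_{\mathcal F}=V_{x,r}$. The generalized $r$-facet containing $x\in\mathcal{B}(G)$ is the set of $y\in\mathcal{B}(G)$ with $\mathfrak{g}_{x,r}=\mathfrak{g}_{y,r}$ and $\mathfrak{g}_{x,r+}=\mathfrak{g}_{y,r+}$; its nonempty intersections with apartments are $r$-facets of one common dimension, which is its dimension. $\mathcal{F}^{\mathcal B}$ denotes the generalized $r$-facet containing $\mathcal{F}$. Pairs and orbits. $v\in V_{\mathcal F}$ is degenerate if it is the image of a nilpotent element of $\mathfrak{g}_{\mathcal F}$; $I_r^n$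 is the set of pairs $(\mathcal{F},v)$ with $\mathcal{F}$ an $r$-facet of $\mathcal{A}$ and $v\in V_{\mathcal F}$ degenerate. A Lie triple is $(Y,H,X)$ with $[H,X]=2X$, $[H,Y]=-2Y$, $[X,Y]=H$. For $(\mathcal{F},v)\in I_r^n$ with $v\ne0$ and $x\in\mathcal{F}$, extend $v$ to a Lie triple $(w,h,v)\in V_{x,-r}\times V_{x,0}\times V_{x,r}$ and lift it to a Lie triple $(Y,H,X)\in\mathfrak{g}_{x,-r}\times\mathfrak{g}_{x,0}\times\mathfrak{g}_{x,r}$ over $k$; then $\mathcal{O}(\mathcal{F},v)=\mathrm{Ad}(G)X$, which (DeBacker) is independent of choices and is the unique nilpotent orbit of minimal dimension meeting the coset $v=X+\mathfrak{g}_{x,r+}$. If $v=0$, $\mathcal{O}(\mathcal{F},v)=\{0\}$ and the triple is $(0,0,0)$. For a Lie triple $(Y,H,X)$, $\mathcal{B}_r(Y,H,X)=\{x\in\mathcal{B}(G):Y\in\mathfrak{g}_{x,-r},X\in\mathfrak{g}_{x,r}\}$, a union of generalized $r$-facets. $(\mathcal{F},v)\in I_r^n$ is distinguished if, for a Lie triple $(Y,H,X)\in\mathfrak{g}_{x,-r}\times\mathfrak{g}_{x,0}\times\mathfrak{g}_{x,r}$ over $k$ (with $x\in\mathcal{F}$) lifting a Lie triple $(w,h,v)\in V_{x,-r}\times V_{x,0}\times V_{x,r}$ that extends $v$ (and $(Y,H,X)=(0,0,0)$ if $v=0$), $\mathcal{F}^{\mathcal B}$ is a generalized $r$-facet of maximal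 dimension in $\mathcal{B}_r(Y,H,X)$. $I_r^d$ is the set of distinguished pairs. *)

(* Defs.v *)
From HB Require Import structures.
From mathcomp Require Import all_boot all_order all_algebra all_fingroup.
From mathcomp Require Import all_classical all_reals all_analysis.

Set Implicit Arguments.
Unset Strict Implicit.
Unset Printing Implicit Defensive.
Import Order.TTheory GRing.Theory Num.Theory.
Import numFieldNormedType.Exports.
Local Open Scope classical_set_scope.
Local Open Scope ring_scope.

(* Non-Archimedean local field: complete for a normalized discrete valuation,
   with finite residue field.  The residue field is carried together with the
   reduction map; [red] is only meaningful on the ring of integers. *)
Record local_field (k : fieldType) := LocalField {
  lfval : k -> \bar int;
  lfvalNy : forall a, lfval a <> -oo%E;
  lfval_eqy : forall a, lfval a = +oo%E <-> a = 0;
  lfvalM : forall a b, lfval (a * b) = (lfval a + lfval b)%E;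
  lfvalD : forall a b, (Order.min (lfval a) (lfval b) <= lfval (a + b))%E;
  lfval_uniformizer : exists a, lfval a = 1%:E;
  lfval_complete : forall u : nat -> k,
    (forall N : int, exists M : nat, forall i j : nat,
       (M <= i)%N -> (M <= j)%N -> (N%:E <= lfval (u i - u j))%E) ->
    exists l : k, forall N : int, exists M : nat, forall i : nat,
       (M <= i)%N -> (N%:E <= lfval (u i - l))%E;
  residue : finFieldType;
  red : k -> residue;
  red1 : red 1 = 1;
  redD : forall a b, (0 <= lfval a)%E -> (0 <= lfval b)%E ->
    red (a + b) = red a + red b;
  redM : forall a b, (0 <= lfval a)%E -> (0 <= lfval b)%E ->
    red (a * b) = red a * red b;
  red_surj : forall c, exists2 a, (0 <= lfval a)%E & red a = c;
  red_ker : forall a, (0 <= lfval a)%E -> (red a = 0 <-> (1%:E <= lfval a)%E)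
}.

Section Matrices.
Context {k : fieldType} {n : nat}.
Implicit Types X Y H g : 'M[k]_n.

Definition SL : set 'M[k]_n := [set g | \det g = 1].
Definition Ad g X : 'M[k]_n := g *m X *m invmx g.
Definition Ad_orbit X : set 'M[k]_n := [set Ad g X | g in SL].
Definition lie X Y : 'M[k]_n := X *m Y - Y *m X.
Definition nilpotent X : Prop := exists m : nat, X ^+ m = 0.
Definition lie_triple Y H X : Prop :=
  [/\ lie H X = X *+ 2, lie H Y = Y *- 2 & lie X Y = H].

(* Exactly one nonzero entry in each row and each column. *)
Definition monomial (m : 'M[k]_n) : Prop :=
  exists s : 'S_n, forall i j, (m i j != 0) = (i == s j).

End Matrices.

Definition is_partition (n : nat) (la : seq nat) : Prop :=
  [/\ sorted geq la, all (fun a => 0 < a)%N la & sumn la = n].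

(* [reshape_index la i] is the number of the block of [la] containing the
   (0-based) position [i]. *)
Definition jordan_mx (k : fieldType) (n : nat) (la : seq nat) : 'M[k]_n :=
  \matrix_(i, j) ((j == i.+1 :> nat) &&
                  (reshape_index la i == reshape_index la j))%:R.

(* Indices here are 1-based, as in the set {1, ..., n}. *)
Definition I_part (n : nat) (la : seq nat) : set nat :=
  [set i | [/\ (1 <= i)%N, (i <= n)%N &
     forall m, (1 <= m <= size la)%N -> i <> sumn (take m la)]].

Section Apartment.
Context {R : realType} {n : nat}.
Implicit Types (x y : 'rV[R]_n) (r : R) (F : set 'rV[R]_n).

Definition apartment : set 'rV[R]_n := [set x | \sum_i x 0 i = 0].

(* [(i, j, m)] stands for the affine function e_i - e_j + m; it is an affine
   root when i <> j. *)
Definition aff_fun : Type := 'I_n * 'I_n * int.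
Definition aff_eval (psi : aff_fun) x : R :=
  let: (i, j, m) := psi in x 0 i - x 0 j + m%:~R.
Definition aff_root : set aff_fun := [set psi | psi.1.1 != psi.1.2].

Definition hyperplane r (psi : aff_fun) : set 'rV[R]_n :=
  [set x | apartment x /\ aff_eval psi x = r].
Definition hyperplanes r (Sigma : set aff_fun) : set 'rV[R]_n :=
  apartment `&` \bigcap_(psi in Sigma) hyperplane r psi.
Definition facet_stratum r (Sigma : set aff_fun) : set 'rV[R]_n :=
  hyperplanes r Sigma `\`
    \bigcup_(psi in aff_root `\` Sigma) hyperplane r psi.

Definition facet r F : Prop :=
  exists Sigma : set aff_fun,
    [/\ finite_set Sigma, Sigma `<=` aff_root &
        exists2 x, facet_stratum r Sigma x
                 & F = connected_component (facet_stratum r Sigma) x].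

Definition aff_space x0 (W : {vspace 'rV[R]_n}) : set 'rV[R]_n :=
  [set x | x - x0 \in W].

(* Dimension of the smallest affine subspace of the apartment containing S. *)
Definition aff_dim (S : set 'rV[R]_n) : nat :=
  xget 0%N [set d | exists x0 W,
    [/\ S `<=` aff_space x0 W,
        aff_space x0 W `<=` apartment,
        (forall x1 W1, S `<=` aff_space x1 W1 ->
           aff_space x1 W1 `<=` apartment ->
           aff_space x0 W `<=` aff_space x1 W1)
      & d = \dim W]].

Definition maximal_facet_in r (S F : set 'rV[R]_n) : Prop :=
  [/\ facet r F, F `<=` S &
      forall F', facet r F' -> F' `<=` S -> (aff_dim F' <= aff_dim F)%N].

(* A chosen point of F: the lattices below are constant on facets. *)
Definition facet_pt F : 'rV[R]_n := xget 0 F.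

End Apartment.

Section Building.
Context {R : realType} {k : fieldType} (K : local_field k) {n : nat}.
Implicit Types (x y : 'rV[R]_n) (r : R) (X Y H : 'M[k]_n).

Definition valr (a : k) : \bar R := er_map intr (lfval K a).

(* For the filtrations below, b = true gives g_{x,r} and b = false gives
   g_{x,r+}. *)

Definition torus_filt (b : bool) r : set 'M[k]_n :=
  [set H | exists2 h : 'rV[k]_n, H = diag_mx h /\ \sum_i h 0 i = 0 &
     forall chi : 'I_n -> int,
       (r%:E < valr (\sum_i h 0 i *~ chi i) ?<= if b)%O].

Definition root_filt (psi : aff_fun) : set 'M[k]_n :=
  let: (i, j, m) := psi in
  [set a *: delta_mx i j | a in [set a | (m%:E <= lfval K a)%E]].

Definition filt (b : bool) x r : set 'M[k]_n :=
  [set X | exists (H : 'M[k]_n) (s : seq aff_fun) (Z : aff_fun -> 'M[k]_n),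
    [/\ torus_filt b r H,
        (forall psi, psi \in s ->
           [/\ aff_root psi, (r < aff_eval psi x ?<= if b)%O
             & root_filt psi (Z psi)])
      & X = H + \sum_(psi <- s) Z psi]].

Definition mp x r := filt true x r.
Definition mp_plus x r := filt false x r.

(* An element of V_{x,r} is represented by the corresponding coset of
   g_{x,r+} in g_{x,r}. *)
Definition img x r X : set 'M[k]_n := [set Z | mp_plus x r (Z - X)].
Definition Vx x r : set (set 'M[k]_n) := [set img x r X | X in mp x r].
Definition Vbracket x r s (v w : set 'M[k]_n) : set 'M[k]_n :=
  [set Z | exists A B, [/\ v A, w B & mp_plus x (r + s) (Z - lie A B)]].
Definition Vscale x r (c : int) (v : set 'M[k]_n) : set 'M[k]_n :=
  [set Z | exists2 A, v A & mp_plus x r (Z - A *~ c)].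
Definition Vlie_triple x r (w h v : set 'M[k]_n) : Prop :=
  [/\ Vx x (- r) w, Vx x 0 h & Vx x r v] /\
  [/\ Vbracket x 0 r h v = Vscale x r 2 v,
      Vbracket x 0 (- r) h w = Vscale x (- r) (- 2) w
    & Vbracket x r (- r) v w = h].

(* The triples used to define the orbit of (F, v). *)
Definition lift_triple x r (v : set 'M[k]_n) Y H X : Prop :=
  (v = img x r 0 /\ [/\ Y = 0, H = 0 & X = 0]) \/
  [/\ v <> img x r 0,
      lie_triple Y H X,
      [/\ mp x (- r) Y, mp x 0 H & mp x r X]
    & exists w h, [/\ Vlie_triple x r w h v,
        w = img x (- r) Y, h = img x 0 H & v = img x r X]].

(* The action y = nu(m) x of the normalizer of the diagonal torus on the
   apartment, normalized so that Ad(m) g_{x,r} = g_{nu(m)x,r}; in particular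
   diag(t_i) acts by x_i |-> x_i - val(t_i). *)
Definition nu (m : 'M[k]_n) x y : Prop :=
  forall i j, m i j != 0 -> y 0 i = x 0 j - (fine (lfval K (m i j)))%:~R.

(* Stabilizer of x in SL_n(k). *)
Definition stab x : set 'M[k]_n :=
  [set g | SL g /\ forall i j, (0 <= valr (g i j) + (x 0 i - x 0 j)%:E)%E].

(* The building is (G x A)/~ with the Bruhat-Tits equivalence
   (g, x) ~ (h, y) iff y = nu(m) x and g^-1 h m fixes x for some m in N(T).
   A point is an equivalence class; [bpt g x] is the point g.x. *)
Definition bpoint : Type := set ('M[k]_n * 'rV[R]_n).
Definition bpt (g : 'M[k]_n) x : bpoint :=
  [set q | [/\ SL q.1, apartment q.2 &
     exists m : 'M[k]_n,
       [/\ SL m, monomial m, nu m x q.2 & stab x (invmx g *m q.1 *m m)]]].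
Definition building : set bpoint :=
  [set z | exists g x, [/\ SL g, apartment x & z = bpt g x]].

Definition bfilt (b : bool) (z : bpoint) r : set 'M[k]_n :=
  [set X | exists g x, z (g, x) /\ exists2 Z, filt b x r Z & X = Ad g Z].

Definition gfacet r (z : bpoint) : set bpoint :=
  [set y | [/\ building y, bfilt true z r = bfilt true y r
                         & bfilt false z r = bfilt false y r]].
Definition is_gfacet r (C : set bpoint) : Prop :=
  exists2 z, building z & C = gfacet r z.

(* Intersection of C with the apartment g.A, transported to A by g^-1. *)
Definition apt_trace (g : 'M[k]_n) (C : set bpoint) : set 'rV[R]_n :=
  [set x | apartment x /\ C (bpt g x)].

(* The common dimension of the nonempty intersections with apartments. *)
Definition gfacet_dim (C : set bpoint) : nat :=
  xget 0%N [set d | exists2 g, SL g &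
    apt_trace g C !=set0 /\ d = aff_dim (apt_trace g C)].

Definition facetB r (F : set 'rV[R]_n) : set bpoint :=
  gfacet r (bpt 1%:M (facet_pt F)).

Definition Br r Y H X : set bpoint :=
  [set z | [/\ building z, bfilt true z (- r) Y & bfilt true z r X]].

Definition g_F r (F : set 'rV[R]_n) : set 'M[k]_n := mp (facet_pt F) r.
Definition img_F r (F : set 'rV[R]_n) X : set 'M[k]_n := img (facet_pt F) r X.
Definition V_F r (F : set 'rV[R]_n) : set (set 'M[k]_n) := Vx (facet_pt F) r.

Definition degenerate r (F : set 'rV[R]_n) (v : set 'M[k]_n) : Prop :=
  exists X, [/\ g_F r F X, nilpotent X & v = img_F r F X].

Definition I_r_n (r : R) : set (set 'rV[R]_n * set 'M[k]_n) :=
  [set Fv | [/\ facet r Fv.1, V_F r Fv.1 Fv.2 & degenerate r Fv.1 Fv.2]].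

(* O(F, v) = Ad(G)X for any admissible triple (Y, H, X); since it does not
   depend on the choices, it is the union over all of them. *)
Definition orbit_of r (F : set 'rV[R]_n) (v : set 'M[k]_n) : set 'M[k]_n :=
  [set Z | exists x Y H X,
     [/\ F x, lift_triple x r v Y H X & Ad_orbit X Z]].

Definition max_in_Br r (F : set 'rV[R]_n) Y H X : Prop :=
  facetB r F `<=` Br r Y H X /\
  forall C, is_gfacet r C -> C `<=` Br r Y H X ->
    (gfacet_dim C <= gfacet_dim (facetB r F))%N.

(* An admissible triple always exists and the condition does not depend on its
   choice; both facts are recorded in the definition. *)
Definition distinguished r (F : set 'rV[R]_n) (v : set 'M[k]_n) : Prop :=
  (exists x Y H X, F x /\ lift_triple x r v Y H X) /\
  (forall x Y H X, F x -> lift_triple x r v Y H X -> max_in_Br r F Y H X).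

Definition I_r_d (r : R) : set (set 'rV[R]_n * set 'M[k]_n) :=
  [set Fv | I_r_n r Fv /\ distinguished r Fv.1 Fv.2].

Definition H_part r (la : seq nat) (d : 'rV[k]_n) : set 'rV[R]_n :=
  hyperplanes r
    [set psi : aff_fun | exists i j : 'I_n,
       [/\ j = i.+1 :> nat, I_part n la i.+1
         & psi = (i, j, fine (lfval K (d 0 j)))]].

End Building.

(* Main.v *)
Require Import Defs.
From mathcomp Require Import all_boot all_order all_algebra all_fingroup.
From mathcomp Require Import all_classical all_reals all_analysis.
From mathcomp Require Import ring lra zify.
Import Order.TTheory GRing.Theory Num.Theory.
Import numFieldNormedType.Exports.
Set Implicit Arguments.
Unset Strict Implicit.
Unset Printing Implicit Defensive.
Local Open Scope classical_set_scope.
Local Open Scope ring_scope.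

(** Let [X] be the Jordan matrix times [D].  Three facts give the theorem.

    - Lie triples split integrally.  For a Lie triple [(Y, H, X)] of [n x n]
      matrices over a field in which [1, ..., n] are invertible, [X] is nilpotent
      and the eigenvalues of [Y X] on the successive quotients of the kernels of
      the powers of [X], above the kernel of [X] itself, are products of two
      positive integers below [n].  Inverting these integers, which are units
      since the residue characteristic is large, yields
      [S = rho(Y X) Y] with [X ^ j S ^ j X ^ j = X ^ j] for all [j]
      ([sl2_pinvX], [triple_pinv]).  As [S] has depth [- r] as soon as [X] and
      [Y] have depths [r] and [- r], every vector that [X ^ j] maps to strictly
      higher depth than expected is congruent to a vector killed by [X ^ j].

    - All lifts are conjugate.  If [(Y', H', X')] is a lift attached to the
      coset of [X], the cyclic vectors of [X] can be corrected to cyclic vectors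
      of [X'].  This gives [g] with [g X = X' g], congruent to the identity, whose
      determinant lies in [1 + P]; completeness provides an [n]-th root of the
      determinant, hence a conjugating element of [SL_n] ([lift_conj]).  So
      [O(F, v)] is the orbit of [X].

    - Dimensions are numbers of components.  Join [i] and [j] when an affine
      root with gradient [e_i - e_j] takes the value [r] at a point [y]: the
      [r]-facet of [y] has dimension [ncomp r y - 1], where [ncomp] counts the
      connected components.  When [g y] belongs to [B_r(Y', H', X')], every
      component produces a vector in the kernel of [X'], and these vectors are
      independent, so [ncomp r y] is at most the number of parts of the partition
      ([ncomp_rank]).  At a generic point of [H_part] the components are the
      blocks, so a maximal facet attains the bound ([maximal_ncomp]).

    The dimension of a generalized facet is defined through an arbitrary
    apartment meeting it.  It is well defined because [ncomp] depends on the two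
    lattices of depth [r] only up to conjugation ([ncomp_le]): the components
    containing an affine root correspond to orthogonal idempotents, visible in
    the quotient of these lattices.  Finally the generalized facet of [F] is
    contained in [B_r(Y', H', X')] because the lattice of depth [- r] at a point
    is the dual, for the trace form, of the one of depth [r+] ([glat_dual]).  *)

(** * Valuations and fractional ideals *)

Section Valuation.
Context {k : fieldType} (K : local_field k).

Definition vl (a : k) : int := fine (lfval K a).

Lemma lfvalE a : a != 0 -> lfval K a = (vl a)%:E.
Proof.
move=> a0; rewrite /vl; case E: (lfval K a) => [m| |] //=.
  by move: a0; rewrite ((lfval_eqy K a).1 E) eqxx.
by case: (lfvalNy E).
Qed.

Lemma lfval0 : lfval K 0 = +oo%E.
Proof. exact/lfval_eqy. Qed.

Lemma vlM a b : a != 0 -> b != 0 -> vl (a * b) = vl a + vl b.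
Proof. by move=> a0 b0; rewrite {1}/vl lfvalM !lfvalE. Qed.

Lemma vl1 : vl 1 = 0.
Proof.
have := @vlM 1 1 (oner_neq0 _) (oner_neq0 _).
by rewrite mulr1 => /eqP; rewrite -subr_eq0 opprD addrA subrr sub0r oppr_eq0 => /eqP.
Qed.

Lemma vlN a : vl (- a) = vl a.
Proof.
have [->|a0] := eqVneq a 0; first by rewrite oppr0.
have m0 : -1 != 0 :> k by rewrite oppr_eq0 oner_neq0.
have : vl (-1 * -1) = vl (-1) + vl (-1) by rewrite vlM.
by rewrite mulrNN mulr1 vl1 -(mulN1r a) vlM //; lia.
Qed.

Lemma vlV a : vl a^-1 = - vl a.
Proof.
have [->|a0] := eqVneq a 0; first by rewrite invr0 /vl lfval0 /= oppr0.
have := @vlM a a^-1 a0; rewrite invr_eq0 divff // vl1 => /(_ a0); lia.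
Qed.

Lemma vlD a b : a != 0 -> b != 0 -> a + b != 0 ->
  Num.min (vl a) (vl b) <= vl (a + b).
Proof.
move=> a0 b0 ab0; have := lfvalD K a b.
rewrite !lfvalE // /Order.min /=.
by rewrite lte_fin; case: ifP => _; rewrite lee_fin.
Qed.

Lemma vl_surj (m : int) : exists2 a : k, a != 0 & vl a = m.
Proof.
have [u hu] := lfval_uniformizer K.
have u0 : u != 0 by apply/eqP => u0; move: hu; rewrite u0 lfval0.
have vu : vl u = 1 by rewrite /vl hu.
have vX (j : nat) : vl (u ^+ j) = j%:Z.
  by elim: j => [|j IH]; rewrite ?expr0 ?vl1 // exprS vlM ?expf_neq0 // IH vu; lia.
case: m => j; first by exists (u ^+ j); rewrite ?expf_neq0.
exists (u ^+ j.+1)^-1; first by rewrite invr_eq0 expf_neq0.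
by rewrite vlV vX NegzE.
Qed.

End Valuation.

Section Depth.
Context {R : realType} {k : fieldType} (K : local_field k).
Implicit Types (s t : R) (a : k) (b : bool).

(** The closed and the open fractional ideal of level [s], selected by a boolean
    as in [filt]; the level is real so that points of the apartment need no
    rounding. *)
Definition depth (b : bool) (s : R) (a : k) : bool :=
  (a == 0) || (s < (vl K a)%:~R ?<= if b).

Lemma dep_valr b s a : (s%:E < valr (R := R) K a ?<= if b)%O = depth b s a.
Proof.
rewrite /depth /valr; have [->|a0] := eqVneq a 0 => /=.
  by rewrite lfval0 /=; case: b => /=; rewrite ?leey ?ltry.
by rewrite lfvalE //=; case: b; rewrite /= ?lee_fin ?lte_fin.
Qed.

Lemma dep0 b s : depth b s 0. Proof. by rewrite /depth eqxx. Qed.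

Lemma depW b s b' s' a : (s' < s ?<= if (b ==> b')) -> depth b s a -> depth b' s' a.
Proof.
rewrite /depth => h /orP[-> //|h2]; apply/orP; right; move: h h2.
by case: b; case: b' => //=; lra.
Qed.

Lemma dep_ge b s a : depth b s a -> depth true s a.
Proof. by apply: depW; case: b => /=; lra. Qed.

Lemma depFW b s a : depth false s a -> depth b s a.
Proof. by case: b => //; apply: dep_ge. Qed.

Lemma depN b s a : depth b s (- a) = depth b s a.
Proof. by rewrite /depth oppr_eq0 vlN. Qed.

Lemma depD b s a c : depth b s a -> depth b s c -> depth b s (a + c).
Proof.
have [->|a0] := eqVneq a 0; first by rewrite add0r.
have [->|c0] := eqVneq c 0; first by rewrite addr0.
have [->|ac0] := eqVneq (a + c) 0; first by rewrite dep0.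
rewrite /depth (negbTE a0) (negbTE c0) (negbTE ac0) /=.
have := vlD K a0 c0 ac0; rewrite -(ler_int R) /Order.min.
by case: b => /=; case: ifP => _; lra.
Qed.

Lemma depB b s a c : depth b s a -> depth b s c -> depth b s (a - c).
Proof. by move=> ha hc; apply: depD; rewrite ?depN. Qed.

Lemma depDr b s a c : depth b s c -> depth b s (a + c) = depth b s a.
Proof.
move=> hc; apply/idP/idP => [h|h]; last exact: depD.
by rewrite -(addrK c a); apply: depB.
Qed.

Lemma dep_sum b s (I : Type) (l : seq I) (P : pred I) (F : I -> k) :
  (forall i, P i -> depth b s (F i)) -> depth b s (\sum_(i <- l | P i) F i).
Proof.
move=> h; apply: (big_ind (depth b s)) => //; first exact: dep0.
by move=> *; apply: depD.
Qed.

Lemma depM b s a b' s' a' : depth b s a -> depth b' s' a' -> depth (b && b') (s + s') (a * a').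
Proof.
have [->|a0] := eqVneq a 0; first by rewrite mul0r !dep0.
have [->|c0] := eqVneq a' 0; first by rewrite mulr0 !dep0.
rewrite /depth (negbTE a0) (negbTE c0) mulf_eq0 (negbTE a0) (negbTE c0) /= vlM //.
by rewrite rmorphD /=; case: b; case: b' => /=; lra.
Qed.

Lemma dep1 : depth true 0 (1 : k).
Proof. by rewrite /depth vl1 /= lexx orbT. Qed.

Lemma dep1F : depth false 0 (1 : k) = false.
Proof. by rewrite /depth oner_eq0 vl1 /= ltxx. Qed.

Lemma dep_nat (m : nat) : depth true 0 (m%:R : k).
Proof. by elim: m => [|m IH]; rewrite ?dep0 // -addn1 natrD depD // dep1. Qed.

Lemma dep_int (m : int) : depth true 0 (m%:~R : k).
Proof. by case: m => m; rewrite ?NegzE ?mulrNz ?depN -pmulrn dep_nat. Qed.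

(** Lying outside the open ideal means having a nonzero image in the graded
    quotient; this determines the valuation. *)
Lemma dep_exact s a : depth true s a -> ~~ depth false s a ->
  a != 0 /\ (vl K a)%:~R = s :> R.
Proof.
rewrite /depth; case: eqP => //= _ h1; rewrite -leNgt => h2; split => //.
by apply/eqP; rewrite eq_le h1 h2.
Qed.

Lemma dep_vl a : depth true (vl K a)%:~R a.
Proof. by rewrite /depth /= lexx orbT. Qed.

Lemma dep_vlF a : a != 0 -> ~~ depth false (vl K a)%:~R a.
Proof. by move=> a0; rewrite /depth /= ltxx (negbTE a0). Qed.

Lemma depMF s a s' a' : a != 0 -> (vl K a)%:~R = s ->
  depth false (s + s') (a * a') -> depth false s' a'.
Proof.
move=> a0 <- h; rewrite -(mulKf a0 a').
have -> : s' = (vl K a^-1)%:~R + ((vl K a)%:~R + s') :> R.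
  by rewrite vlV mulrNz; lra.
exact: (@depM true _ _ false _ _ (dep_vl _) h).
Qed.

Definition int_unit (a : k) : bool := depth true (0 : R) a && ~~ depth false (0 : R) a.

Lemma int_unitE a : int_unit a = (a != 0) && (vl K a == 0).
Proof.
rewrite /int_unit /depth; case: eqP => //= _.
by rewrite -leNgt -eq_le -[0 : R]/(0%:~R) eqr_int eq_sym.
Qed.

Lemma int_unit_neq0 a : int_unit a -> a != 0.
Proof. by rewrite int_unitE => /andP[]. Qed.

Lemma int_unitV a : int_unit a -> int_unit a^-1.
Proof.
rewrite !int_unitE => /andP[a0 /eqP va].
by rewrite invr_eq0 a0 vlV va oppr0.
Qed.

Lemma int_unit_dep a : int_unit a -> depth true 0 a.
Proof. by case/andP. Qed.

Section ResidueChar.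
Variables (p : nat) (char_p : p \in [pchar (residue K)]).

Lemma red0 : red K 0 = 0.
Proof. by apply/red_ker; rewrite lfval0 leey. Qed.

Lemma dep_lfval a : depth true 0 a -> (0 <= lfval K a)%E.
Proof.
rewrite /depth; have [->|a0] := eqVneq a 0; first by rewrite lfval0 leey.
by rewrite /= lfvalE // lee_fin -[0 : R]/(0%:~R) ler_int.
Qed.

Lemma red_nat (m : nat) : red K m%:R = m%:R.
Proof.
elim: m => [|m IH]; first exact: red0.
by rewrite -addn1 !natrD redD ?IH ?red1 //; apply: dep_lfval; rewrite ?dep1 ?dep_nat.
Qed.

Lemma int_unit_nat (m : nat) : (0 < m < p)%N -> int_unit m%:R.
Proof.
move=> /andP[m0 mp]; rewrite /int_unit dep_nat /=; apply/negP => h.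
have : red K m%:R = 0.
  have hv : (1%:E <= lfval K m%:R)%E.
    move: h; rewrite /depth; have [->|n0] := eqVneq (m%:R : k) 0; first by rewrite lfval0 leey.
    by rewrite /= lfvalE // lee_fin -[0 : R]/(0%:~R) ltr_int; lia.
  by apply/red_ker => //; apply: le_trans hv.
rewrite red_nat => /eqP; rewrite -(dvdn_pcharf char_p) => /dvdn_leq; lia.
Qed.

(** Allows cardinals to be compared through traces modulo the maximal ideal. *)
Lemma dep_nat_eq (m m' : nat) : (m < p)%N -> (m' < p)%N ->
  depth false 0 (m%:R - m'%:R : k) -> m = m'.
Proof.
wlog le_mm : m m' / (m <= m')%N => [th mp mp' h|mp mp' h].
  case/orP: (leq_total m m') => le; first exact: th.
  by apply/esym/th => //; rewrite -opprB depN.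
have [->//|neq] := eqVneq m m'.
have /int_unit_nat/andP[_] : (0 < m' - m < p)%N by apply/andP; split; lia.
by rewrite natrB // -opprB depN h.
Qed.

End ResidueChar.
End Depth.

(** * Roots of principal units *)

Section Roots.
Context {R : realType} {k : fieldType} (K : local_field k).
Local Notation dep := (@depth R k K).
Local Notation int_unit := (@int_unit R k K).

Lemma dep_lfval_int (N : int) a : dep true N%:~R a = (N%:E <= lfval K a)%E.
Proof.
rewrite /depth; have [->|a0] := eqVneq a 0; first by rewrite lfval0 leey.
by rewrite /= lfvalE // lee_fin ler_int.
Qed.

Definition princ_unit (a : k) : bool := dep true 1 (a - 1).

Lemma princ_unit_dep a : princ_unit a -> dep true 0 a.
Proof.
move=> h; rewrite -(subrK 1 a); apply: depD (dep1 K).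
by apply: depW h => /=; lra.
Qed.

Lemma princ_unit1 : princ_unit 1.
Proof. by rewrite /princ_unit subrr dep0. Qed.

Lemma princ_unitM a c : princ_unit a -> princ_unit c -> princ_unit (a * c).
Proof.
move=> ha hc; rewrite /princ_unit.
have -> : a * c - 1 = a * (c - 1) + (a - 1) by ring.
apply: depD => //.
by rewrite -(add0r (1 : R)); apply: (depM (b := true) (b' := true)) => //; exact: princ_unit_dep.
Qed.

Lemma princ_unitX a m : princ_unit a -> princ_unit (a ^+ m).
Proof.
move=> ha; elim: m => [|m IH]; first exact: princ_unit1.
by rewrite exprS princ_unitM.
Qed.

Lemma princ_unit_sumX a c m : princ_unit a -> princ_unit c ->
  dep true 1 (\sum_(i < m) a ^+ (m.-1 - i) * c ^+ i - m%:R).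
Proof.
move=> ha hc.
have -> : m%:R = \sum_(i < m) 1 :> k by rewrite sumr_const card_ord.
rewrite -sumrB; apply: dep_sum => i _.
by apply: princ_unitM; apply: princ_unitX.
Qed.

Lemma princ_unit_unit a : princ_unit a -> int_unit a.
Proof.
move=> h; rewrite /int_unit princ_unit_dep //=.
apply/negP => h0; have : dep false 0 1.
  have -> : 1 = a - (a - 1) by ring.
  by apply: depB => //; apply: depW h => /=; lra.
by rewrite dep1F.
Qed.

(** Newton's method for [X ^ n - a]: each step of the iteration
    [c |-> c + (a - c ^ n) / n] gains at least one unit of valuation, and
    completeness provides the limit. *)
Lemma princ_unit_root a n : int_unit n%:R -> princ_unit a -> exists c, c ^+ n = a.
Proof.
move=> un ha.
have n0 := int_unit_neq0 un.
pose step (c : k) : k := c + (a - c ^+ n) / n%:R.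
pose c j : k := iter j step 1.
have cS j : c j.+1 = c j + (a - c j ^+ n) / n%:R by [].
have stepE s d : dep true s d -> dep true s (d / n%:R).
  move=> hd; rewrite -(addr0 s); apply: (depM (b := true) (b' := true)) => //.
  exact/int_unit_dep/int_unitV.
have hc j : princ_unit (c j) /\ dep true j.+1%:R (a - c j ^+ n).
  elim: j => [|j [IH1 IH2]]; first by rewrite /c /= expr1n princ_unit1.
  have small : dep true j.+1%:R ((a - c j ^+ n) / n%:R) by exact: stepE.
  have pS : princ_unit (c j.+1).
    rewrite /princ_unit cS addrAC; apply: depD => //.
    by apply: depW small => /=; rewrite ler1n.
  split => //.
  have -> : a - c j.+1 ^+ n = (a - c j ^+ n) / n%:R *
      (n%:R - \sum_(i < n) c j.+1 ^+ (n.-1 - i) * c j ^+ i).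
    have e : c j.+1 - c j = (a - c j ^+ n) / n%:R by rewrite cS; ring.
    rewrite mulrBr divfK // -e -subrXX; ring.
  rewrite -(addn1 j.+1) natrD; apply: (depM (b := true) (b' := true)) => //.
  by rewrite -opprB depN; apply: princ_unit_sumX.
have cauchy j m : dep true j.+1%:R (c (j + m)%N - c j).
  elim: m => [|m IH]; first by rewrite addn0 subrr dep0.
  rewrite addnS cS addrAC; apply: depD => //; apply: stepE.
  by apply: depW (hc _).2 => /=; rewrite ler_nat; lia.
have [|l hl] := @lfval_complete _ K c.
  move=> N; exists `|N|%N => i j hi hj.
  have le (s : nat) : (N%:~R : R) <= s.+1%:R -> (`|N| <= s)%N -> dep true N%:~R (c s - c `|N|%N).
    move=> h1 h2; have := cauchy `|N|%N (s - `|N|)%N; rewrite subnKC //.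
    by apply: depW => /=; rewrite -[X in _ <= X]mulrz_nat ler_int; lia.
  rewrite -dep_lfval_int.
  have -> : c i - c j = (c i - c `|N|%N) - (c j - c `|N|%N) by ring.
  by apply: depB; apply: le => //; rewrite -[X in _ <= X]mulrz_nat ler_int; lia.
have {}hl (N : nat) : exists2 i : nat, (N <= i)%N & dep true N%:R (c i - l).
  have [M hM] := hl N; exists (maxn N M); first exact: leq_maxl.
  by have := hM _ (leq_maxr N M); rewrite -dep_lfval_int.
have pl : princ_unit l.
  have [i _ hi] := hl 1%N.
  have -> : l = c i - (c i - l) by ring.
  rewrite /princ_unit addrAC; apply: depB => //; exact: (hc i).1.
exists l; apply/eqP; rewrite -subr_eq0; apply/negPn/negP => ne.
pose N := `|vl K (l ^+ n - a)|.+1.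
have [i Ni hi] := hl N.
have : dep true N%:R (l ^+ n - a).
  have -> : l ^+ n - a = (l ^+ n - c i ^+ n) - (a - c i ^+ n) by ring.
  apply: depB; last by apply: depW (hc i).2 => /=; rewrite ler_nat; lia.
  rewrite subrXX -(addr0 N%:R); apply: (depM (b := true) (b' := true)).
    by rewrite -opprB depN.
  by apply: dep_sum => j _; apply: princ_unit_dep;
    apply: princ_unitM; apply: princ_unitX => //; exact: (hc i).1.
rewrite /depth (negbTE ne) /= -[N%:R]mulrz_nat ler_int /N; lia.
Qed.

End Roots.

(** * Moy-Prasad lattices in gl_n *)

Lemma submxE (V : zmodType) (m n : nat) (A B : 'M[V]_(m, n)) i j : (A - B) i j = A i j - B i j.
Proof. by rewrite [LHS]mxE; congr (_ + _); rewrite mxE. Qed.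

Section Lattices.
Context {R : realType} {k : fieldType} (K : local_field k) {n : nat}.
Implicit Types (x y : 'rV[R]_n) (r : R) (X Y Z : 'M[k]_n) (b : bool).
Local Notation dep := (@depth R k K).

(** The filtration of [gl_n] at [x].  Unlike that of [sl_n] it is stable under
    products and contains scalar matrices; [filt] is its traceless part. *)
Definition glat b x r : set 'M[k]_n :=
  [set Z | forall i j, dep b (r + (x 0 j - x 0 i)) (Z i j)].

Lemma glat0 b x r : glat b x r 0.
Proof. by move=> i j; rewrite mxE dep0. Qed.

Lemma glatD b x r X Y : glat b x r X -> glat b x r Y -> glat b x r (X + Y).
Proof. by move=> hX hY i j; rewrite mxE depD. Qed.

Lemma glatN b x r X : glat b x r X -> glat b x r (- X).
Proof. by move=> hX i j; rewrite mxE depN. Qed.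

Lemma glatB b x r X Y : glat b x r X -> glat b x r Y -> glat b x r (X - Y).
Proof. by move=> hX hY; apply: glatD => //; apply: glatN. Qed.

Lemma glat_sum b x r (I : Type) (l : seq I) (P : pred I) (Z : I -> 'M[k]_n) :
  (forall i, P i -> glat b x r (Z i)) -> glat b x r (\sum_(i <- l | P i) Z i).
Proof.
move=> h; apply: (big_ind (glat b x r)) => //; first exact: glat0.
by move=> *; apply: glatD.
Qed.

Lemma glatM b x r X b' r' X' : glat b x r X -> glat b' x r' X' ->
  glat (b && b') x (r + r') (X *m X').
Proof.
move=> hX hX' i j; rewrite mxE; apply: dep_sum => l _.
have -> : r + r' + (x 0 j - x 0 i) = (r + (x 0 l - x 0 i)) + (r' + (x 0 j - x 0 l)) by lra.
exact: depM.
Qed.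

Lemma glatM1 x X X' r : glat true x 0 X -> glat true x r X' -> glat true x r (X *m X').
Proof. by move=> h h'; rewrite -(add0r r); apply: (glatM h h'). Qed.

Lemma glat_lie b x r X b' r' X' : glat b x r X -> glat b' x r' X' ->
  glat (b && b') x (r + r') (lie X X').
Proof.
move=> h h'; apply: glatB; first exact: glatM.
by rewrite andbC addrC; apply: glatM.
Qed.

Lemma glatZ b x r c X : dep true 0 c -> glat b x r X -> glat b x r (c *: X).
Proof. by move=> hc hX i j; rewrite mxE -[r](add0r) -addrA; apply: (depM hc (hX i j)). Qed.

Lemma glat_scalar b x r c : dep b r c -> glat b x r c%:M.
Proof.
move=> hc i j; rewrite mxE; have [->|_] := eqVneq i j; last by rewrite mulr0n dep0.
by rewrite subrr addr0.
Qed.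

Lemma glat1 x : glat true x 0 1%:M.
Proof. exact/glat_scalar/dep1. Qed.

Lemma glat_ge b x r X : glat b x r X -> glat true x r X.
Proof. by move=> h i j; apply: dep_ge (h i j). Qed.

Lemma glatX x r X m : glat true x r X -> glat true x (r *+ m) (X ^+ m).
Proof.
move=> hX; elim: m => [|m IH]; first exact: glat1.
by rewrite exprS mulrS; apply: (glatM hX IH).
Qed.

Lemma glat_trace b x r X : glat b x r X -> dep b r (\tr X).
Proof.
move=> h; apply: dep_sum => i _.
by have := h i i; rewrite subrr addr0.
Qed.

Lemma glat_diff b x r X Y : glat b x r (X - Y) -> glat b x r Y -> glat b x r X.
Proof. by move=> h1 h2; rewrite -(subrK Y X); apply: glatD. Qed.

Lemma root_filt_glat b x r (psi : aff_fun) Z : aff_root psi ->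
  (r < aff_eval psi x ?<= if b) -> root_filt K psi Z -> \tr Z = 0 /\ glat b x r Z.
Proof.
case: psi => [[i j] m] /= ij hr [a /= ha <-]; split.
  by rewrite mxtraceZ /mxtrace big1 ?mulr0 // => l _;
    rewrite mxE; case: eqP => //= ->; rewrite (negbTE ij).
move=> i' j'; rewrite !mxE.
have [->|_] := eqVneq i' i; last by rewrite mulr0 dep0.
have [->|_] := eqVneq j' j; last by rewrite mulr0 dep0.
rewrite mulr1; have : dep true m%:~R a by rewrite dep_lfval_int.
by apply: depW; move: hr; case: b => /=; lra.
Qed.

(** Evaluating characters at coordinates, and conversely expanding a matrix into
    elementary ones, reduces membership in [filt] to entrywise inequalities. *)
Lemma filt_glat b x r X : filt K b x r X <-> \tr X = 0 /\ glat b x r X.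
Proof.
split.
  move=> [H [s [Z [[h [-> h0] hH] hZ ->]]]].
  have hD : \tr (diag_mx h) = 0 /\ glat b x r (diag_mx h).
    split; first by rewrite mxtrace_diag.
    move=> i j; rewrite mxE; have [<-|_] := eqVneq i j; last by rewrite mulr0n dep0.
    have := hH (fun l => (l == i)%:Z); rewrite dep_valr subrr addr0 mulr1n.
    by rewrite (bigD1 i) //= eqxx mulr1z big1 ?addr0 // => l /negbTE ->; rewrite mulr0z.
  have hS (psi : aff_fun) : psi \in s -> \tr (Z psi) = 0 /\ glat b x r (Z psi).
    by move=> /hZ[h1 h2 h3]; apply: root_filt_glat h3.
  split.
    by rewrite raddfD /= hD.1 raddf_sum /= big_seq big1 ?addr0 // => psi /hS[].
  by apply: glatD hD.2 _; rewrite big_seq; apply: glat_sum => psi /hS[].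
move=> [t0 hX].
pose P (q : 'I_n * 'I_n) := (q.1 != q.2) && (X q.1 q.2 != 0).
exists (diag_mx (\row_i X i i)), [seq (q.1, q.2, vl K (X q.1 q.2)) | q <- enum P],
  (fun psi => X psi.1.1 psi.1.2 *: delta_mx psi.1.1 psi.1.2).
split.
- exists (\row_i X i i).
    by split => //; rewrite -[RHS]t0; apply: eq_bigr => i _; rewrite mxE.
  move=> chi; rewrite dep_valr; apply: dep_sum => i _; rewrite mxE -mulrzr.
  rewrite -[r]addr0 -[b]andbT; apply: depM; last exact: dep_int.
  by have := hX i i; rewrite subrr addr0.
- move=> psi /mapP[[i j]]; rewrite mem_enum unfold_in /P /= => /andP[ij Xij] -> /=; split => //.
    by have := hX i j; rewrite /depth (negbTE Xij) /= {ij Xij t0}; case: b {hX} => /=; lra.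
  by exists (X i j) => //=; rewrite lfvalE.
- rewrite big_map /= big_enum_cond /=; apply/matrixP => i j.
  rewrite !mxE summxE.
  rewrite (eq_bigr (fun q => X q.1 q.2 * ((i == q.1) && (j == q.2))%:R)); last first.
    by move=> q _; rewrite !mxE.
  have [<-|ij] := eqVneq i j.
    rewrite mulr1n big1 ?addr0 // => -[a c]; rewrite unfold_in /P /= => /andP[/andP[ac _] _].
    by case: (eqVneq i a) => [->|]; rewrite ?mulr0 //= (negbTE ac) mulr0.
  rewrite mulr0n add0r; have [X0|X0] := eqVneq (X i j) 0.
    rewrite big1 // => -[a c] _ /=.
    case: (eqVneq i a) => [<-|]; rewrite ?mulr0 //=.
    by case: (eqVneq j c) => [<-|]; rewrite ?mulr0 // X0 mul0r.
  rewrite (bigD1 (i, j)) /=; last by rewrite unfold_in /P /= ij X0.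
  rewrite !eqxx mulr1 big1 ?addr0 // => -[a c] /andP[_ ne] /=.
  case: (eqVneq i a) => [ia|]; rewrite ?mulr0 //=; case: (eqVneq j c) => [jc|]; rewrite ?mulr0 //.
  by move: ne; rewrite -ia -jc eqxx.
Qed.

(** An entry [Z i j] of insufficient valuation is detected by pairing [Z] with
    the elementary matrix [(Z i j)^-1 E_ji], which then has depth [r]. *)
Lemma glat_dual b x r Z :
  glat (~~ b) x (- r) Z <-> forall W, glat b x r W -> dep false 0 (\tr (Z *m W)).
Proof.
split=> [hZ W hW|h i j].
  have -> : 0 = - r + r by rewrite addNr.
  by have := glat_trace (glatM hZ hW); case: b {hZ hW}.
have [->|Z0] := eqVneq (Z i j) 0; first exact: dep0.
apply/negPn/negP => hn.
have := h ((Z i j)^-1 *: delta_mx j i).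
have -> : \tr (Z *m ((Z i j)^-1 *: delta_mx j i)) = 1.
  rewrite -scalemxAr mxtraceZ /mxtrace (bigD1 i) //= big1 => [|l li].
    rewrite mxE (bigD1 j) //= !mxE !eqxx mulr1 big1 ?addr0 ?mulVf // => l lj.
    by rewrite mxE (negbTE lj) mulr0.
  by rewrite mxE big1 // => l' _; rewrite !mxE (negbTE li) andbF mulr0.
rewrite dep1F => hf; suff : false by []; apply: hf => a c; rewrite !mxE.
have [->|_] := eqVneq a j; last by rewrite mulr0 dep0.
have [->|_] := eqVneq c i; last by rewrite mulr0 dep0.
rewrite mulr1; move: hn; rewrite /depth (negbTE Z0) invr_eq0 (negbTE Z0) vlV mulrNz /=.
by case: b {h} => /=; rewrite -?ltNge -?leNgt; lra.
Qed.

End Lattices.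

(** * Points of the building and their filtrations *)

Section Adjoint.
Context {k : fieldType} {n : nat}.
Implicit Types (g h X Y Z : 'M[k]_n).

Lemma SL_unitmx g : SL g -> g \in unitmx.
Proof. by rewrite /SL /= unitmxE => ->; rewrite unitr1. Qed.

Lemma SL1 : SL (1%:M : 'M[k]_n).
Proof. exact: det1. Qed.

Lemma SLM g h : SL g -> SL h -> SL (g *m h).
Proof. by rewrite /SL /= det_mulmx => -> ->; rewrite mulr1. Qed.

Lemma SLV g : SL g -> SL (invmx g).
Proof. by rewrite /SL /= det_inv => ->; rewrite invr1. Qed.

Lemma invmxM g h : g \in unitmx -> h \in unitmx -> invmx (g *m h) = invmx h *m invmx g.
Proof.
move=> ug uh; have ugh : g *m h \in unitmx by rewrite unitmx_mul ug.
apply: (can_inj (mulKmx ugh)); rewrite mulmxV // mulmxA mulmxK //.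
by rewrite mulmxV.
Qed.

Lemma Ad1 X : Ad 1%:M X = X.
Proof. by rewrite /Ad invmx1 mul1mx mulmx1. Qed.

Lemma AdM g h X : g \in unitmx -> h \in unitmx -> Ad (g *m h) X = Ad g (Ad h X).
Proof. by move=> ug uh; rewrite /Ad invmxM // !mulmxA. Qed.

Lemma AdK g X : g \in unitmx -> Ad (invmx g) (Ad g X) = X.
Proof. by move=> ug; rewrite -AdM ?unitmx_inv // mulVmx // Ad1. Qed.

Lemma AdVK g X : g \in unitmx -> Ad g (Ad (invmx g) X) = X.
Proof. by move=> ug; rewrite -AdM ?unitmx_inv // mulmxV // Ad1. Qed.

Lemma Ad_tr g X : g \in unitmx -> \tr (Ad g X) = \tr X.
Proof. by move=> ug; rewrite /Ad mxtrace_mulC mulmxA mulVmx // mul1mx. Qed.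

Lemma AdD g X Y : Ad g (X + Y) = Ad g X + Ad g Y.
Proof. by rewrite /Ad mulmxDr mulmxDl. Qed.

Lemma AdB g X Y : Ad g (X - Y) = Ad g X - Ad g Y.
Proof. by rewrite /Ad mulmxBr mulmxBl. Qed.

Lemma AdMM g X Y : g \in unitmx -> Ad g (X *m Y) = Ad g X *m Ad g Y.
Proof. by move=> ug; rewrite /Ad !mulmxA mulmxKV. Qed.

Lemma Ad_scalar g c : g \in unitmx -> Ad g c%:M = c%:M.
Proof. by move=> ug; rewrite /Ad scalar_mxC -mulmxA mulmxV ?mulmx1. Qed.

Lemma Ad_lie g X Y : g \in unitmx -> Ad g (lie X Y) = lie (Ad g X) (Ad g Y).
Proof. by move=> ug; rewrite /lie AdB !AdMM. Qed.

Lemma Ad_lie_triple g Y H X : g \in unitmx -> lie_triple Y H X ->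
  lie_triple (Ad g Y) (Ad g H) (Ad g X).
Proof.
move=> ug [h1 h2 h3]; split; rewrite -Ad_lie // ?h1 ?h2 ?h3 //.
  by rewrite !mulr2n AdD.
by rewrite !mulr2n /Ad mulmxN mulNmx mulmxDr mulmxDl.
Qed.

Lemma Ad_orbit_eq g X : SL g -> Ad_orbit (Ad g X) = Ad_orbit X.
Proof.
move=> sg; have ug := SL_unitmx sg.
apply/seteqP; split=> Z [h sh <-].
  by exists (h *m g); [exact: SLM|rewrite AdM // SL_unitmx].
exists (h *m invmx g); first exact/SLM/SLV.
by rewrite AdM ?unitmx_inv ?SL_unitmx // AdK.
Qed.

End Adjoint.

Section Transport.
Context {R : realType} {k : fieldType} (K : local_field k) {n : nat}.
Implicit Types (x y : 'rV[R]_n) (r : R) (g h m s X Y Z : 'M[k]_n) (b : bool).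
Local Notation dep := (@depth R k K).
Local Notation glat := (@glat R k K n).

(** A point [x] of the apartment is the norm on [k ^ n] for which the standard
    basis splits with levels [x 0 i]; [g] maps the norm [x] onto the norm [y].
    Both fixators of points and monomial matrices are of this kind. *)
Definition carries x y g : Prop :=
  [/\ g \in unitmx, forall i j, dep true (x 0 j - y 0 i) (g i j)
    & forall i j, dep true (y 0 j - x 0 i) (invmx g i j)].

Lemma carriesV x y g : carries x y g -> carries y x (invmx g).
Proof. by case=> ug h1 h2; split; rewrite ?unitmx_inv ?invmxK. Qed.

Lemma carries_glat b x y r g Z : carries x y g -> glat b x r Z -> glat b y r (Ad g Z).
Proof.
move=> [_ h1 h2] hZ i j; rewrite mxE; apply: dep_sum => l _; rewrite mxE mulr_suml.
apply: dep_sum => l' _.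
have -> : r + (y 0 j - y 0 i) = ((x 0 l' - y 0 i) + (r + (x 0 l - x 0 l'))) + (y 0 j - x 0 l) by lra.
by have := depM (depM (h1 i l') (hZ l' l)) (h2 l j); rewrite andbT.
Qed.

Lemma dep_prod (I : finType) (P : pred I) (s : I -> R) (a : I -> k) :
  (forall i, P i -> dep true (s i) (a i)) ->
  dep true (\sum_(i | P i) s i) (\prod_(i | P i) a i).
Proof.
move=> h; apply: (big_ind2 (fun t c => dep true t c)) => //; first exact: dep1.
by move=> t c t' c' h1 h2; exact: (depM h1 h2).
Qed.

Lemma dep_sign (e : bool) (t : R) a : dep true t a -> dep true t ((-1) ^+ e * a).
Proof. by case: e; rewrite ?expr0 ?expr1 ?mul1r // mulN1r depN. Qed.

(** The levels of the factors in the expansion of a minor add up to a quantity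
    that depends only on the omitted row and column. *)
Lemma glat_inv x g : \det g = 1 -> glat true x 0 g -> glat true x 0 (invmx g).
Proof.
move=> dg hg i j; rewrite /invmx unitmxE dg unitr1 invr1 scale1r !mxE /cofactor.
rewrite -signr_odd; apply: dep_sign; apply: dep_sum => s _.
apply: dep_sign.
have -> : 0 + (x 0 j - x 0 i) =
    \sum_l (0 + (x 0 (lift i (s l)) - x 0 (lift j l))).
  rewrite (eq_bigr (fun l => x 0 (lift i (s l)) - x 0 (lift j l))) => [|l _]; last by rewrite add0r.
  rewrite sumrB -(reindex_inj (h := s) (P := xpredT) (F := fun l => x 0 (lift i l)) (@perm_inj _ s)).
  have e l : \sum_l' x 0 (lift l l') = (\sum_l' x 0 l') - x 0 l.
    by rewrite [X in _ = X - _](bigD1_ord l) //= addrAC subrr add0r.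
  by rewrite !e; lra.
by apply: dep_prod => l _; rewrite !mxE; exact: hg.
Qed.

Lemma stab_carries x s : stab K x s -> carries x x s.
Proof.
move=> [ss hs]; have us := SL_unitmx ss.
have gs : glat true x 0 s.
  move=> i j; have := hs i j; rewrite /valr /depth.
  have [->|s0] := eqVneq (s i j) 0; first by [].
  by rewrite lfvalE //= -EFinD lee_fin; lra.
by split=> // i j; rewrite -[_ - _]add0r; [exact: gs|exact: glat_inv].
Qed.

Lemma monomial_carries m x y : monomial m -> nu K m x y -> carries x y m.
Proof.
move=> [s hs] hnu.
pose mi := \matrix_(i, j) (m j i)^-1.
have mmi : m *m mi = 1%:M.
  apply/matrixP => i i'; rewrite !mxE; have [<-|ii] := eqVneq i i'.
    rewrite (bigD1 ((s^-1)%g i)) //= mxE divff ?big1 ?addr0 ?hs ?permKV //.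
    move=> j jne; suff -> : m i j = 0 by rewrite mul0r.
    apply/eqP/negPn/negP; rewrite hs => /eqP e; move: jne.
    by rewrite e permK eqxx.
  rewrite big1 // => j _; rewrite mxE; have [->|] := eqVneq (m i j) 0; first by rewrite mul0r.
  rewrite hs => /eqP e; have [->|] := eqVneq (m i' j) 0; first by rewrite invr0 mulr0.
  by rewrite hs => /eqP e'; move: ii; rewrite e e' eqxx.
have um : m \in unitmx by case: (mulmx1_unit mmi).
have -> : carries x y m <-> (forall i j, dep true (x 0 j - y 0 i) (m i j)) /\
   (forall i j, dep true (y 0 j - x 0 i) (mi i j)).
  have -> : mi = invmx m by rewrite -[mi](mulKmx um) mmi mulmx1.
  by split=> [[]|[]].
split=> i j; rewrite ?mxE.
  have [->|m0] := eqVneq (m i j) 0; first exact: dep0.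
  by rewrite (hnu i j m0) /depth /vl /= (negbTE m0) /=; lra.
have [->|m0] := eqVneq (m j i) 0; first by rewrite invr0 dep0.
by rewrite (hnu j i m0) /depth vlV /vl /= invr_eq0 (negbTE m0) mulrNz /=; lra.
Qed.

Lemma filt_Ad b x y r g Z : carries x y g -> filt K b x r Z -> filt K b y r (Ad g Z).
Proof.
move=> cg /filt_glat[t0 hZ]; apply/filt_glat.
by split; [rewrite Ad_tr //; case: cg|exact: carries_glat hZ].
Qed.

Lemma bpt_refl g x : SL g -> apartment x -> bpt K g x (g, x).
Proof.
move=> sg ax; split => //; exists 1%:M; split.
- exact: SL1.
- by exists 1%g => i j; rewrite mxE perm1; case: (i == j); rewrite ?oner_eq0 ?eqxx.
- move=> i j; rewrite mxE; have [<- _|_] := eqVneq i j; last by rewrite eqxx.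
  by rewrite -[fine _]/(vl K 1) vl1 subr0.
- rewrite mulmx1 mulVmx ?SL_unitmx //; split; first exact: SL1.
  move=> i j; rewrite mxE; have [<-|_] := eqVneq i j; rewrite /=.
    by rewrite subrr adde0 /valr lfvalE ?oner_eq0 // vl1.
  by rewrite mulr0n /valr lfval0 /= addye ?leey.
Qed.

Lemma bpt_building g x : SL g -> apartment x -> building K (bpt K g x).
Proof. by exists g, x. Qed.

(** Representatives of the same point differ by a monomial matrix and an element
    of a fixator, so any one of them computes the filtration. *)
Lemma bfilt_bpt b g x r X : SL g -> apartment x ->
  bfilt K b (bpt K g x) r X <-> filt K b x r (Ad (invmx g) X).
Proof.
move=> sg ax; split; last first.
  move=> h; exists g, x; split; first exact: bpt_refl.
  by exists (Ad (invmx g) X) => //; rewrite AdVK // SL_unitmx.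
move=> [h [y [[/= sh ay [m [sm mm num st]]] hZ0]]]; case: hZ0 => Z hZ ->.
have [[ug uh] um] := (SL_unitmx sg, SL_unitmx sh, SL_unitmx sm).
set s := invmx g *m h *m m in st.
have cs := stab_carries st; have us : s \in unitmx by case: cs.
have -> : Ad (invmx g) (Ad h Z) = Ad s (Ad (invmx m) Z).
  by rewrite /s !AdM ?unitmx_mul ?unitmx_inv ?ug ?uh // AdVK.
by apply: filt_Ad cs _; apply: filt_Ad hZ; apply/carriesV/monomial_carries.
Qed.

End Transport.

(** * Lie triples: the layers of the kernels of powers of X *)

Section SL2.
Context {k : fieldType} {A : algType k}.
Variables (X Y H : A).
Hypotheses (HX : H * X = X * H + X *+ 2) (HY : H * Y = Y * H - Y *+ 2).
Hypothesis XY : X * Y = Y * X + H.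
Local Notation B := (Y * X).

Lemma sl2_XnY j : X ^+ j.+1 * Y = Y * X ^+ j.+1 + ((H - j%:R) * X ^+ j) *+ j.+1.
Proof.
elim: j => [|j IH]; first by rewrite !expr1 expr0 mulr1 subr0 XY.
rewrite exprS -mulrA IH mulrDr mulrA XY mulrDl -mulrA -exprS -addrA; congr (_ + _).
have XH : X * H = H * X - X *+ 2 by rewrite HX addrK.
have -> : X * (((H - j%:R) * X ^+ j) *+ j.+1) = ((H - j.+2%:R) * X ^+ j.+1) *+ j.+1.
  rewrite mulrnAr; congr (_ *+ _); rewrite mulrA mulrBr XH -mulr_natr.
  rewrite -(mulr_natr X 2) exprS mulrA; congr (_ * _).
  by rewrite mulrBl mulr_natl !mulr_natr -addrA -opprD -mulrnDr.
have -> : H * X ^+ j.+1 = (H - j.+1%:R) * X ^+ j.+1 + X ^+ j.+1 *+ j.+1.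
  by rewrite mulrBl mulr_natl subrK.
have -> : (H - j.+2%:R) * X ^+ j.+1 = (H - j.+1%:R) * X ^+ j.+1 - X ^+ j.+1.
  by rewrite -(addn1 j.+1) natrD opprD addrA mulrBl mul1r.
by rewrite mulrnBl [RHS]mulrS -addrA [X in _ + X]addrC subrK.
Qed.

Variables (N : nat) (XN : X ^+ N = 0).
Hypothesis unitN : forall j, (0 < j <= N)%N -> j%:R != 0 :> k.

Local Notation opH v s := (foldl (fun w i => (H - i%:R) * w) v s).

Lemma opH_scale c v s : opH (c *: v) s = c *: opH v s.
Proof. by elim: s v => //= i s IH v; rewrite -IH scalerAr. Qed.

(** On the highest weight vectors in the image of [X ^ j], the element [H] acts as
    [j] modulo the image of [X ^ (j + 1)]; iterating up to [N] shows that the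
    weights of such vectors are among [j, ..., N - 1]. *)
Lemma highest_weights m j u : (j + m = N)%N -> X ^+ j.+1 * u = 0 ->
  opH (X ^+ j * u) (iota j m) = 0.
Proof.
elim: m j u => [|m IH] j u jm hu /=; first by rewrite -(addn0 j) jm XN mul0r.
have j0 : j.+1%:R != 0 :> k by apply: unitN; lia.
have e : (H - j%:R) * (X ^+ j * u) = X ^+ j.+1 * (j.+1%:R^-1 *: (Y * u)).
  rewrite -scalerAr [X ^+ _ * (Y * u)]mulrA sl2_XnY [(_ + _ *+ _) * u]mulrDl -(mulrA Y) hu mulr0 add0r.
  by rewrite -[(_ * X ^+ j) *+ _]scaler_nat -scalerAl scalerA mulVf // scale1r mulrA.
rewrite e; apply: IH; first by lia.
rewrite exprS -mulrA -e mulrA mulrBr.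
have -> : X * H = (H - 2) * X by rewrite mulrBl mulr_natl HX addrK.
rewrite mulr_natr -(mulr_natl X) -mulrBl -mulrA [X * _]mulrA -exprS hu.
exact: mulr0.
Qed.

Variable P : A -> Prop.
Hypotheses (P0 : P 0) (P1 : P 1) (PB : P B).
Hypotheses (PD : forall a b, P a -> P b -> P (a + b)) (PN : forall a, P a -> P (- a)).
Hypothesis (PM : forall a b, P a -> P b -> P (a * b)).
Hypothesis (PZ : forall j a, (0 < j <= N)%N -> P a -> P (j%:R^-1 *: a)).

(** The operators that will push all of [A] into the kernel of [X]; [P] records a
    property that their coefficients inherit from [B], such as integrality. *)
Let good T := exists2 rho, P rho & T = 1 - rho * B.

Let good1 : good 1.
Proof. by exists 0 => //; rewrite mul0r subr0. Qed.

Let goodM T T' : good T -> good T' -> good (T * T').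
Proof.
move=> [rho hr ->] [rho' hr' ->]; exists (rho + rho' - rho * B * rho').
  by apply: PD; [exact: PD|apply/PN/PM => //; exact: PM].
have -> : (rho + rho' - rho * B * rho') * B = rho * B + rho' * B - rho * B * (rho' * B).
  by rewrite mulrBl mulrDl !mulrA.
rewrite mulrBl mul1r mulrBr mulr1; move: (rho * B) (rho' * B) (rho * B * (rho' * B)) => a b c.
by rewrite -addrA -opprD addrA (addrC b).
Qed.

(** Hence [B] acts as [(j + 1) (H + j + 2)] on the kernel of [X ^ (j + 2)] modulo
    that of [X ^ (j + 1)]. *)
Let B_layer j u : X ^+ j.+2 * u = 0 ->
  X ^+ j.+1 * (B * u) = j.+1%:R *: ((H - j%:R) * (X ^+ j.+1 * u)).
Proof.
move=> hu; rewrite -[Y * X * u]mulrA [LHS]mulrA sl2_XnY mulrDl -(mulrA Y).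
rewrite [X ^+ j.+1 * (X * u)]mulrA -exprSr hu mulr0 add0r mulrnAl.
by rewrite -[(_ * (X * u)) *+ _]scaler_nat -!mulrA [X ^+ j * _]mulrA -exprSr.
Qed.

(** By [highest_weights], the eigenvalues of [B] on this layer are the products
    [(j + 1) (i - j)] with [j < i < N]; they are invertible, so the factors
    [1 - B / c] annihilate the layer one eigenvalue at a time. *)
Lemma kill_layer j m i : (j < i)%N -> (i + m = N)%N ->
  exists2 T, good T & forall u, X ^+ j.+2 * u = 0 ->
    opH (X ^+ j.+1 * u) (iota i m) = 0 -> X ^+ j.+1 * (T * u) = 0.
Proof.
elim: m i => [|m IH] i ji im /=.
  by exists 1 => // u; rewrite mul1r.
have [||T gT hT] := IH i.+1; [lia|lia|].
have [j1 uj ui] : [/\ j.+1%:R != 0 :> k, (0 < j.+1 <= N)%N & (0 < i - j <= N)%N].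
  by split; [apply: unitN|..]; lia.
have i1 := unitN ui.
pose c : k := j.+1%:R * (i - j)%:R.
exists (T * (1 - c^-1 *: B)).
  apply: goodM => //; exists c^-1%:A; last by rewrite -scalerAl mul1r.
  by rewrite /c invfM -scalerA; apply: PZ => //; apply: PZ.
move=> u hu hH; rewrite -mulrA; apply: hT.
  rewrite mulrBl mul1r mulrBr -scalerAl -scalerAr hu.
  by rewrite B_layer ?hu ?mulr0 ?scaler0 ?subrr // exprS -mulrA hu mulr0.
rewrite mulrBl mul1r mulrBr -scalerAl -scalerAr B_layer // scalerA.
have -> : X ^+ j.+1 * u - (c^-1 * j.+1%:R) *: ((H - j%:R) * (X ^+ j.+1 * u)) =
   (- (c^-1 * j.+1%:R)) *: ((H - i%:R) * (X ^+ j.+1 * u)).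
  have -> : H - j%:R = (H - i%:R) + (i - j)%:R%:A.
    rewrite scaler_nat (_ : i%:R = (i - j)%:R + j%:R); first by rewrite opprD addrA addrAC subrK.
    by rewrite -natrD; congr _%:R; lia.
  rewrite mulrDl scalerDr opprD addrCA scaleNr -[RHS]addr0; congr (_ + _).
  rewrite -scalerAl mul1r scalerA /c -mulrA mulVf ?scale1r ?subrr //.
  by rewrite mulf_neq0.
by rewrite opH_scale hH scaler0.
Qed.

(** The product of the operators of [kill_layer] over all layers above the kernel
    of [X] has the form [1 - rho B] and its image is killed by [X]. *)
Lemma sl2_pinv : exists2 rho, P rho & X * (rho * Y) * X = X.
Proof.
have main j : (j < N)%N -> exists2 T, good T & forall u, X ^+ j.+1 * u = 0 -> X * (T * u) = 0.
  elim: j => [|j IH] jN; first by exists 1 => // u; rewrite mul1r expr1.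
  have [|T gT hT] := IH; first lia.
  have [||T' gT' hT'] := @kill_layer j (N - j.+1) j.+1; [lia|lia|].
  exists (T * T'); first exact: goodM.
  move=> u hu; rewrite -mulrA; apply: hT; apply: hT' => //.
  by apply: highest_weights => //; lia.
have [N0|N0] := posnP N.
  by exists 0 => //; have := oner_neq0 A; rewrite -(expr0 X) -{1}N0 XN eqxx.
have [|T [rho hr ->] hT] := main N.-1; first lia.
exists rho => //; have := hT 1; rewrite prednK // XN mul0r => /(_ erefl).
rewrite mulr1 mulrBr mulr1 => /eqP; rewrite subr_eq0 => /eqP e.
by rewrite [RHS]e !mulrA.
Qed.

End SL2.

(** * Lie triples: generalized inverses and nilpotency *)

Section SL2Powers.
Context {k : fieldType} {A : algType k}.
Variables (X Y H : A).
Hypotheses (HX : H * X = X * H + X *+ 2) (HY : H * Y = Y * H - Y *+ 2).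
Hypothesis XY : X * Y = Y * X + H.
Local Notation B := (Y * X).

Let HX1 : H * X = X * (H + 2).
Proof. by rewrite HX mulrDr mulr_natr. Qed.
Let HX2 : (H - 2) * X = X * H.
Proof. by rewrite mulrBl HX mulr_natl addrK. Qed.
Let HY1 : H * Y = Y * (H - 2).
Proof. by rewrite HY mulrBr mulr_natr. Qed.
Let HY2 : (H + 2) * Y = Y * H.
Proof. by rewrite mulrDl HY mulr_natl subrK. Qed.

(** The Casimir element; [casE] is its image under the symmetry exchanging [X]
    with [Y] and [H] with [- H]. *)
Let cas := (H + 2) * H + B *+ 4.

Let casE : cas = H * (H - 2) + (X * Y) *+ 4.
Proof.
have e : H *+ 4 = H *+ 2 + H *+ 2 by rewrite -mulrnDr.
rewrite /cas XY mulrnDl mulrDl mulrBr mulr_natl mulr_natr e.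
move: (H *+ 2) (B *+ 4) (H * H) => a b c.
by rewrite -!addrA [- a + _]addrCA addKr [b + a]addrC.
Qed.

Let cas_X : X * cas = cas * X.
Proof.
rewrite [in RHS]casE mulrDl mulrDr mulrnAr mulrnAl -!mulrA HX2; congr (_ + _).
by rewrite !mulrA HX1.
Qed.

Let cas_Y : Y * cas = cas * Y.
Proof.
rewrite [in LHS]casE mulrDl mulrDr mulrnAr mulrnAl -!mulrA HY1; congr (_ + _).
by rewrite !mulrA HY2.
Qed.

Let comm_HB : H * B = B * H.
Proof. by rewrite mulrA HY1 -!mulrA HX2. Qed.

Variables (N : nat) (XN : X ^+ N = 0).
Hypothesis unitN : forall j, (0 < j <= N)%N -> j%:R != 0 :> k.
Hypothesis unit2 : 2%:R != 0 :> k.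
Variable P : A -> Prop.
Hypotheses (P0 : P 0) (P1 : P 1) (PB : P B).
Hypotheses (PD : forall a b, P a -> P b -> P (a + b)) (PN : forall a, P a -> P (- a)).
Hypothesis (PM : forall a b, P a -> P b -> P (a * b)).
Hypothesis (PZ : forall j a, (0 < j <= N)%N -> P a -> P (j%:R^-1 *: a)).

(** The generalized inverse [S = rho Y] of [X] has weight [-2] and commutes
    with the Casimir element, so [S X] commutes with each [X ^ j S ^ j]; hence
    the powers of [S] are generalized inverses of the powers of [X]. *)
Lemma sl2_pinvX : exists2 rho, P rho &
  forall j, X ^+ j * (rho * Y) ^+ j * X ^+ j = X ^+ j.
Proof.
pose bicomm Z := forall T, T * B = B * T -> T * Z = Z * T.
have [] := @sl2_pinv k A X Y H HX XY N XN unitN (fun Z => P Z /\ bicomm Z).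
- by split=> // T _; rewrite mulr0 mul0r.
- by split=> // T _; rewrite mulr1 mul1r.
- by split=> // T.
- move=> a b [ha ca] [hb cb]; split; first exact: PD.
  by move=> T hT; rewrite mulrDr mulrDl ca ?cb.
- move=> a [ha ca]; split; first exact: PN.
  by move=> T hT; rewrite mulrN mulNr ca.
- move=> a b [ha ca] [hb cb]; split; first exact: PM.
  by move=> T hT; rewrite mulrA ca // -mulrA cb // mulrA.
- move=> j a hj [ha ca]; split; first exact: PZ.
  by move=> T hT; rewrite -scalerAr -scalerAl ca.
move=> rho [hrho cr] e; exists rho => //; set S := rho * Y in e *.
have rH : H * rho = rho * H by apply: cr.
have rC : cas * rho = rho * cas.
  have h2 : (H + 2) * B = B * (H + 2) by rewrite mulrDl mulrDr comm_HB mulr_natl mulr_natr.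
  apply: cr; rewrite /cas [LHS]mulrDl [RHS]mulrDr mulrnAl mulrnAr; congr (_ + _).
  by rewrite -mulrA comm_HB mulrA h2 mulrA.
have SC : S * cas = cas * S by rewrite /S -mulrA cas_Y mulrA -rC mulrA.
have HS : H * S = S * (H - 2) by rewrite /S mulrA rH -!mulrA HY1.
pose q j := X ^+ j * S ^+ j.
have q0 : q 0%N = 1 by rewrite /q !expr0 mul1r.
have qS j : q j.+1 = X * q j * S by rewrite /q exprS exprSr !mulrA.
have qE j : X ^+ j * S ^+ j = q j by [].
have SE : S = rho * Y by [].
have casB : B *+ 4 = cas - (H + 2) * H by rewrite /cas addrC addKr.
clearbody q S cas.
have qC j : cas * q j = q j * cas.
  elim: j => [|j IH]; first by rewrite q0 mul1r mulr1.
  by rewrite qS !mulrA -cas_X -(mulrA X) IH !mulrA -(mulrA _ cas) -SC !mulrA.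
have qH j : H * q j = q j * H.
  elim: j => [|j IH]; first by rewrite q0 mul1r mulr1.
  have SH : S * H = (H + 2) * S by rewrite mulrDl HS mulrBr mulr_natr mulr_natl subrK.
  rewrite qS !mulrA HX1 -!mulrA SH; congr (X * _).
  by rewrite !mulrA mulrDl mulrDr IH mulr_natl mulr_natr.
have qB j : q j * B = B * q j.
  have : (B *+ 4) * q j = q j * (B *+ 4).
    have h2 : (H + 2) * q j = q j * (H + 2) by rewrite mulrDl mulrDr qH mulr_natl mulr_natr.
    by rewrite casB mulrBl mulrBr qC -mulrA qH mulrA h2 mulrA.
  rewrite mulrnAl mulrnAr => /eqP; rewrite -[_ *+ 4]scaler_nat -[X in _ == X]scaler_nat.
  rewrite -subr_eq0 -scalerBr scaler_eq0 (natrM _ 2 2) mulf_eq0 (negbTE unit2) /=.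
  by rewrite subr_eq0 => /eqP.
have qSX j : q j * (S * X) = (S * X) * q j.
  by rewrite SE -(mulrA rho) mulrA (cr (q j) (qB j)) -mulrA qB !mulrA.
elim=> [|j IH]; first by rewrite !expr0 !mulr1.
rewrite qE qS exprS.
have -> : X * q j * S * (X * X ^+ j) = X * (q j * (S * X)) * X ^+ j by rewrite !mulrA.
have -> : X * (q j * (S * X)) = X * q j by rewrite qSX !mulrA e.
by rewrite -mulrA -qE IH.
Qed.

End SL2Powers.

Section Nilpotent.
Context {k : fieldType} {n : nat}.
Variables (X H : 'M[k]_n.+1).
Hypothesis HX : H * X = X * H + X *+ 2.

(** The derivation [ad H] multiplies [X] by [2], so it acts on the polynomials in
    [X] as twice the Euler operator. *)
Lemma ad_horner (f : {poly k}) :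
  H * horner_mx X f - horner_mx X f * H = horner_mx X ('X * f^`()) *+ 2.
Proof.
elim/poly_ind: f => [|f c IH].
  by rewrite deriv0 mulr0 !rmorph0 mulr0 mul0r subrr mul0rn.
have comm : H * c%:M = c%:M * H by rewrite -!mulmxE scalar_mxC.
rewrite derivD derivC addr0 derivM derivX mulr1 !rmorphD !rmorphM /= horner_mx_X horner_mx_C.
move: IH; rewrite rmorphM /= horner_mx_X; set F := horner_mx X f => IH.
have cX : X * F = F * X.
  by have := congr1 (horner_mx X) (mulrC 'X f); rewrite !rmorphM /= horner_mx_X.
have {}IH : H * F = F * H + (X * horner_mx X f^`()) *+ 2 by rewrite -IH addrC subrK.
rewrite !mulrDr !mulrDl comm opprD addrACA subrr addr0 mulrA IH mulrDl -!mulrA HX.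
rewrite mulrDr addrC !addrA [- _ + _]addrC subrr add0r mulrnAl mulrnAr -mulrnDl.
by rewrite !rmorphD !rmorphM /= horner_mx_X addrC -cX -!mulrA -mulrDr -/F addrC.
Qed.

(** Applying [ad H] to the minimal polynomial [f], of degree [d], shows that
    [d f - X f'] also annihilates [X]; being of smaller degree it vanishes, so [f]
    is a monomial. *)
Lemma sl2_nilpotent : (forall j, (0 < j <= n.+1)%N -> j%:R != 0 :> k) ->
  2%:R != 0 :> k -> X ^+ n.+1 = 0.
Proof.
move=> unitN unit2; pose f := mxminpoly X.
have fX : horner_mx X f = 0 by exact: mx_root_minpoly.
have mf : f \is monic by exact: mxminpoly_monic.
have f0 : f != 0 by exact: monic_neq0.
have Xf' : horner_mx X ('X * f^`()) = 0.
  have := ad_horner f; rewrite fX mulr0 mul0r subrr => /esym/eqP.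
  by rewrite -scaler_nat scaler_eq0 (negbTE unit2) => /eqP.
pose d := (size f).-1.
have sf : size f = d.+1 by rewrite prednK // size_poly_gt0.
have dn : (d <= n.+1)%N.
  have := dvdp_leq (monic_neq0 (char_poly_monic X)) (mxminpoly_dvd_char X).
  by rewrite size_char_poly -/f sf.
pose q := f *+ d - 'X * f^`().
have qE i : q`_i = f`_i *+ d - f`_i *+ i.
  by rewrite coefB coefMn coefXM coef_deriv; case: i => //; rewrite mulr0n.
have q0 : q = 0.
  have : f %| q.
    by apply: mxminpoly_min; rewrite rmorphB rmorphMn /= fX Xf' mul0rn subrr.
  apply: contraTeq => q0; apply/negP => /(dvdp_leq q0); rewrite sf ltnNge => /negP; apply.
  apply/leq_sizeP => i; rewrite leq_eqVlt qE => /orP[/eqP ->|di]; first by rewrite subrr.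
  by rewrite nth_default ?sf // !mul0rn subrr.
have fE : f = 'X^d.
  apply/polyP => i; rewrite coefXn; have [->|ne] := eqVneq i d.
    by have /monicP := mf; rewrite lead_coefE sf.
  have [id|di] := ltnP i d; last by rewrite nth_default ?sf //; lia.
  have := qE i; rewrite q0 coef0 -mulrnBr ?(ltnW id) // => /esym/eqP.
  rewrite -[_ *+ (d - i)]mulr_natr mulf_eq0 => /orP[/eqP //|].
  by rewrite (negbTE (unitN _ _)) //; lia.
have : X ^+ d = 0 by rewrite -fX fE rmorphXn /= horner_mx_X.
have -> : X ^+ n.+1 = X ^+ (n.+1 - d) * X ^+ d by rewrite -exprD subnK.
by move=> ->; rewrite mulr0.
Qed.

End Nilpotent.

(** * Conjugacy of lifts; the standard triple *)

Section GradedInverse.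
Context {R : realType} {k : fieldType} (K : local_field k) {n : nat}.
Variables (p : nat) (char_p : p \in [pchar (residue K)]).
Hypotheses (n_lt_p : (n.+1 < p)%N) (p_gt2 : (2 < p)%N).
Implicit Types (x : 'rV[R]_n.+1) (X Y H : 'M[k]_n.+1).

Lemma small_nat_neq0 (j : nat) : (0 < j < p)%N -> j%:R != 0 :> k.
Proof. by move=> hj; apply: (int_unit_neq0 (R := R) (K := K)); apply: int_unit_nat hj. Qed.

Lemma triple_nilpotent Y H X : lie_triple Y H X -> X ^+ n.+1 = 0.
Proof.
move=> [hHX _ _]; apply: (@sl2_nilpotent _ _ X H); last exact: small_nat_neq0.
  by apply/eqP; rewrite addrC -subr_eq; apply/eqP.
by move=> j hj; apply: small_nat_neq0; lia.
Qed.

Lemma triple_pinv x r Y H X : lie_triple Y H X ->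
  glat K true x r X -> glat K true x (- r) Y ->
  exists2 S, glat K true x (- r) S & forall j, X ^+ j * S ^+ j * X ^+ j = X ^+ j.
Proof.
move=> tr hX hY; have XN := triple_nilpotent tr; case: tr => hHX hHY hXY.
have hx : H * X = X * H + X *+ 2 by apply/eqP; rewrite addrC -subr_eq; apply/eqP.
have hy : H * Y = Y * H - Y *+ 2 by apply/eqP; rewrite addrC -subr_eq; apply/eqP.
have xy : X * Y = Y * X + H by apply/eqP; rewrite addrC -subr_eq; apply/eqP.
have [||||||||| rho hr e] := @sl2_pinvX _ _ X Y H hx hy xy n.+1 XN _ _ (glat K true x 0).
- by move=> j hj; apply: small_nat_neq0; lia.
- exact: small_nat_neq0.
- exact: glat0.
- exact: glat1.
- by have := glatM hY hX; rewrite addNr.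
- by move=> a b; apply: glatD.
- by move=> a; apply: glatN.
- by move=> a b; apply: glatM1.
- move=> j a hj; apply: glatZ; apply/int_unit_dep/int_unitV/(int_unit_nat char_p); lia.
- by exists (rho * Y) => //; apply: glatM1.
Qed.

End GradedInverse.

Section Determinant.
Context {R : realType} {k : fieldType} (K : local_field k) {n : nat}.
Implicit Types (x : 'rV[R]_n) (g : 'M[k]_n).

Lemma depF0 a : depth (R := R) K false 0 a = depth (R := R) K true 1 a.
Proof.
rewrite /depth; case: eqP => //= _.
by rewrite -[0 : R]/(0%:~R) -[1 : R]/(1%:~R) ltr_int ler_int.
Qed.

Lemma sum_perm_diff x (s : 'S_n) : \sum_i (x 0 (s i) - x 0 i) = 0.
Proof.
by rewrite sumrB -(reindex_inj (h := s) (P := xpredT) (F := fun l => x 0 l) (@perm_inj _ s)) subrr.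
Qed.

(** A nontrivial permutation involves an off-diagonal entry, which lies in an open
    ideal; the levels along a permutation add up to zero. *)
Lemma det_princ_unit x g : glat K false x 0 (g - 1%:M) -> princ_unit (R := R) K (\det g).
Proof.
move=> hg; have g1 : glat K true x 0 g.
  by apply: glat_diff (glat1 K x); apply: glat_ge hg.
rewrite /princ_unit /determinant (bigD1 1%g) //= odd_perm1 mul1r addrAC.
apply: depD.
  apply: (big_ind (princ_unit (R := R) K)).
  - exact: princ_unit1.
  - by move=> a b; apply: princ_unitM.
  - by move=> i _; have := hg i i; rewrite !mxE perm1 eqxx subrr addr0 depF0.
rewrite -depF0; apply: dep_sum => s s1.
have [i hi] : exists i, s i != i.
  apply/existsP; apply: contraNT s1 => /existsPn h; apply/eqP/permP => i.
  by rewrite perm1; apply/eqP/negPn/h.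
rewrite mulr_sign; have -> : forall a,
    depth (R := R) K false 0 (if s then - a else a) = depth (R := R) K false 0 a.
  by move=> a; case: ifP; rewrite ?depN.
rewrite (bigD1 i) //= -(sum_perm_diff x s) (bigD1 i) //=.
apply: (depM (b := false) (b' := true)).
  by have := hg i (s i); rewrite !mxE eq_sym (negbTE hi) subr0 add0r.
by apply: dep_prod => l _; rewrite -[_ - _]add0r.
Qed.

End Determinant.

(** A matrix in Jordan form times a diagonal one is encoded by the successor
    relation [nxt] inside the blocks, the position [off] of an index in its block
    and the diagonal entries [d].  The hypothesis [hx] says that its nonzero
    entries have depth exactly [r] at [x]. *)
Section Block.
Context {R : realType} {k : fieldType} (K : local_field k) {n : nat}.
Variables (p : nat) (char_p : p \in [pchar (residue K)]).
Hypothesis n_lt_p : (n.+1 < p)%N.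
Variables (nxt : rel 'I_n.+1) (off : 'I_n.+1 -> nat) (d : 'I_n.+1 -> k).
Hypotheses (nxtS : forall i j, nxt i j -> j = i.+1 :> nat).
Hypothesis off_nxt : forall i j, nxt i j -> off j = (off i).+1.
Hypothesis off0 : forall j, (forall i, ~~ nxt i j) -> off j = 0%N.
Hypothesis d0 : forall i, d i != 0.
Variables (x : 'rV[R]_n.+1) (r : R).
Hypothesis hx : forall i j, nxt i j -> x 0 i - x 0 j + (vl K (d j))%:~R = r.

Let X0 : 'M[k]_n.+1 := \matrix_(i, j) ((nxt i j)%:R * d j).
(** The Moore-Penrose inverse of [X0]. *)
Let W : 'M[k]_n.+1 := \matrix_(j, i) ((nxt i j)%:R / d j).

Let nxt_inj i i' j : nxt i j -> nxt i' j -> i = i'.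
Proof. by move=> /nxtS h /nxtS h'; apply: val_inj; apply: succn_inj; rewrite -h -h'. Qed.
Let nxt_fun i j j' : nxt i j -> nxt i j' -> j = j'.
Proof. by move=> /nxtS h /nxtS h'; apply: val_inj; rewrite /= h h'. Qed.

Let WX0E j l : (W * X0) j l = ([exists i, nxt i j] && (j == l))%:R.
Proof.
rewrite -mulmxE mxE; have [/existsP[i ij]|/existsPn h] := boolP [exists i, nxt i j].
  rewrite (bigD1 i) //= !mxE ij mul1r big1 ?addr0 => [|i' ii].
    have [<-|jl] := eqVneq j l; first by rewrite ij mul1r mulVf.
    by case e : (nxt i l); rewrite ?mul0r ?mulr0 //; rewrite (nxt_fun ij e) eqxx in jl.
  rewrite !mxE; case e : (nxt i' j); rewrite ?mul0r //.
  by rewrite (nxt_inj ij e) eqxx in ii.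
by rewrite big1 // => i _; rewrite !mxE (negbTE (h i)) !mul0r.
Qed.

Let X0WE i l : (X0 * W) i l = ([exists j, nxt i j] && (i == l))%:R.
Proof.
rewrite -mulmxE mxE; have [/existsP[j ij]|/existsPn h] := boolP [exists j, nxt i j].
  rewrite (bigD1 j) //= !mxE ij mul1r big1 ?addr0 => [|j' jj].
    have [<-|il] := eqVneq i l; first by rewrite ij mul1r mulfV.
    by case e : (nxt l j); rewrite ?mul0r ?mulr0 //; rewrite (nxt_inj ij e) eqxx in il.
  rewrite !mxE; case e : (nxt i j'); rewrite ?mul0r //.
  by rewrite (nxt_fun ij e) eqxx in jj.
by rewrite big1 // => j _; rewrite !mxE (negbTE (h j)) !mul0r.
Qed.

Let X0WX0 : X0 * W * X0 = X0.
Proof.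
apply/matrixP => i l; rewrite -mulmxE mxE (bigD1 i) //= X0WE eqxx andbT.
rewrite big1 ?addr0 => [|j ji]; last by rewrite X0WE eq_sym (negbTE ji) andbF mul0r.
case: existsP => [_|h]; first by rewrite mul1r.
rewrite mul0r mxE; case e : (nxt i l); rewrite ?mul0r //.
by case: h; exists l.
Qed.

Let X0n_supp m i j : (X0 ^+ m) i j != 0 -> off j = (off i + m)%N.
Proof.
elim: m i j => [|m IH] i j;
  first by rewrite expr0 mxE addn0; have [->|] := eqVneq i j; rewrite /= ?eqxx.
rewrite exprS -mulmxE mxE => h; apply/eqP; apply: contraNT h => ne.
apply/eqP; apply: big1 => l _; rewrite mxE; case e : (nxt i l); last by rewrite !mul0r.
have [->|/IH hl] := eqVneq ((X0 ^+ m) l j) 0; first by rewrite mulr0.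
by move: ne; rewrite hl (off_nxt e) addSnnS eqxx.
Qed.

Let Wn_supp m i j : (W ^+ m) j i != 0 -> off j = (off i + m)%N.
Proof.
elim: m i j => [|m IH] i j;
  first by rewrite expr0 mxE addn0; have [->|] := eqVneq i j; rewrite /= ?eqxx.
rewrite exprS -mulmxE mxE => h; apply/eqP; apply: contraNT h => ne.
apply/eqP; apply: big1 => l _; rewrite mxE; case e : (nxt l j); last by rewrite !mul0r.
have [->|/IH hl] := eqVneq ((W ^+ m) l i) 0; first by rewrite mulr0.
by move: ne; rewrite (off_nxt e) hl addnS eqxx.
Qed.

Lemma block_glat : glat K true x r X0.
Proof.
move=> i j; rewrite mxE; case e : (nxt i j); last by rewrite mul0r dep0.
rewrite mul1r; apply: depW (dep_vl K (d j)) => /=.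
by have := hx e; lra.
Qed.

Let W_glat : glat K true x (- r) W.
Proof.
move=> j i; rewrite mxE; case e : (nxt i j); last by rewrite mul0r dep0.
rewrite mul1r; apply: depW (dep_vl K (d j)^-1) => /=.
by rewrite vlV mulrNz; have := hx e; lra.
Qed.

(** As [1 - S ^ j X ^ j] projects onto the kernel of [X ^ j], the last basis vector
    of a block of size [j], which [X ^ j] sends to higher depth, is congruent to a
    vector killed by [X ^ j]; its images under the powers of [X] give a new basis
    congruent to the standard one. *)
Lemma lift_conj X S : X ^+ n.+1 = 0 -> X0 ^+ n.+1 = 0 ->
  glat K true x (- r) S -> (forall j, X ^+ j * S ^+ j * X ^+ j = X ^+ j) ->
  glat K false x r (X - X0) -> exists2 g, SL g & X = Ad g X0.
Proof.
move=> Xn X0n hS hXS hXX0.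
have hX0 := block_glat.
have hX : glat K true x r X by apply: glat_diff block_glat; apply: glat_ge hXX0.
pose E := 1 - X0 * W; pose Es := 1 - W * X0.
pose Pi j := 1 - S ^+ j * X ^+ j.
(* If [h] is the last index of its block, column [h] of [U] is the corrected
   cyclic vector, since [off h + 1] is the size of the block; the other columns
   vanish because [E] is the projector onto the last indices. *)
pose U : 'M[k]_n.+1 := \matrix_(l, h) ((Pi (off h).+1) l h * E h h).
have XPi j : X ^+ j * Pi j = 0 by rewrite mulrBr mulr1 mulrA hXS subrr.
have EE h l : E h l = (h == l)%:R - (X0 * W) h l.
  by rewrite submxE; congr (_ - _); rewrite mxE.
have EsE h l : Es h l = (h == l)%:R - (W * X0) h l.
  by rewrite submxE; congr (_ - _); rewrite mxE.
have E_diag h l : h != l -> E h l = 0.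
  by move=> /negbTE hl; rewrite EE X0WE hl andbF subr0.
have UE V l i : (U * V) l i = \sum_h (Pi (off h).+1) l h * (E * V) h i.
  rewrite -mulmxE mxE; apply: eq_bigr => h _; rewrite mxE -mulrA; congr (_ * _).
  rewrite [RHS]mxE (bigD1 h) //= big1 ?addr0 // => l' hl.
  by rewrite E_diag 1?eq_sym // mul0r.
have EX0 : E * X0 = 0 by rewrite mulrBl mul1r X0WX0 subrr.
have UX0 : U * X0 = 0.
  by apply/matrixP => l i; rewrite UE EX0 [RHS]mxE big1 // => h _; rewrite [X in _ * X]mxE mulr0.
have UW j : U * (W ^+ j * Es) = Pi j.+1 * (E * (W ^+ j * Es)).
  apply/matrixP => l i; rewrite UE [RHS]mxE; apply: eq_bigr => h _.
  have [->|ne] := eqVneq ((E * (W ^+ j * Es)) h i) 0; first by rewrite !mulr0.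
  suff -> : off h = j by [].
  have : (W ^+ j * Es) h i != 0.
    apply: contraNneq ne => e; rewrite -mulmxE mxE (bigD1 h) //= mulmxE e mulr0 add0r big1 // => l' hl.
    by rewrite E_diag 1?eq_sym // mul0r.
  have Es_diag a : a != i -> Es a i = 0.
    by move=> /negbTE hl; rewrite EsE WX0E hl andbF subr0.
  have -> : (W ^+ j * Es) h i = (W ^+ j) h i * Es i i.
    by rewrite -mulmxE mxE (bigD1 i) //= big1 ?addr0 // => a ai; rewrite Es_diag // mulr0.
  rewrite mulf_eq0 negb_or => /andP[/Wn_supp ->] Eii.
  rewrite off0 // => i'; apply: contraNN Eii => e.
  rewrite EsE WX0E eqxx andbT; case: existsP => [_|[]]; last by exists i'.
  by rewrite subrr.
(* [W ^ j] moves an index to the one [j] places further in its block, so [g] maps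
   the basis vectors of a block to the images of its cyclic vector, normalized by
   the entries of [X0]. *)
pose g := \sum_(j < n.+1) X ^+ j * U * W ^+ j.
have gX0 : X * g = g * X0.
  rewrite /g [in LHS]big_ord_recr [in RHS]big_ord_recl /= mulrDr mulrDl expr0 mul1r mulr1 UX0 add0r.
  rewrite [X in _ + X](_ : _ = 0) ?addr0; last by rewrite !mulrA -exprS Xn !mul0r.
  rewrite mulr_sumr mulr_suml; apply: eq_bigr => j _ /=.
  rewrite /bump add1n (exprSr W) -[in RHS]mulrA -[W ^+ j * W * X0]mulrA.
  have -> : W * X0 = 1 - Es by rewrite /Es opprB addrC subrK.
  have -> : X ^+ j.+1 * U * (W ^+ j * (1 - Es)) =
      X ^+ j.+1 * U * W ^+ j - X ^+ j.+1 * (U * (W ^+ j * Es)).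
    by rewrite mulrBr mulr1 mulrBr !mulrA.
  by rewrite UW [X ^+ j.+1 * (Pi _ * _)]mulrA XPi mul0r subr0 !mulrA -exprS.
have hE : glat K true x 0 E.
  apply: glatB (glat1 K x) _; rewrite -mulmxE.
  by have := glatM block_glat W_glat; rewrite subrr.
have depth0 m : r *+ m + - r *+ m = 0 by rewrite mulNrn subrr.
have hXn m : glat K false x (r *+ m) (X ^+ m - X0 ^+ m).
  elim: m => [|m IH]; first by rewrite !expr0 subrr; apply: glat0.
  have -> : X ^+ m.+1 - X0 ^+ m.+1 = X * (X ^+ m - X0 ^+ m) + (X - X0) * X0 ^+ m.
    by rewrite mulrBr mulrBl -!exprS addrA subrK.
  rewrite mulrS; apply: glatD; first exact: (glatM (b := true) (b' := false)).
  by apply: (glatM (b := false) (b' := true)) => //; apply: glatX.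
have hUE : glat K false x 0 (U - E).
  move=> l h; set m := (off h).+1.
  have -> : (U - E) l h = Pi m l h * E h h - E l h.
    by rewrite submxE; congr (_ - _); rewrite mxE.
  have -> : Pi m l h * E h h - E l h = - ((S ^+ m * X ^+ m) l h * E h h).
    have -> : E l h = (l == h)%:R * E h h.
      by have [->|lh] := eqVneq l h; rewrite ?mul1r // mul0r E_diag.
    rewrite -mulrBl -mulNr; congr (_ * _).
    have -> : Pi m l h = (l == h)%:R - (S ^+ m * X ^+ m) l h.
      by rewrite submxE; congr (_ - _); rewrite mxE.
    by rewrite addrAC subrr add0r.
  rewrite depN -[0 + _]addr0; apply: (depM (b := false) (b' := true)); last first.
    by have := hE h h; rewrite subrr addr0.
  have -> : (S ^+ m * X ^+ m) l h = (S ^+ m * (X ^+ m - X0 ^+ m)) l h.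
    have -> : (S ^+ m * (X ^+ m - X0 ^+ m)) l h = (S ^+ m * X ^+ m) l h - (S ^+ m * X0 ^+ m) l h.
      by rewrite mulrBr submxE.
    suff -> : (S ^+ m * X0 ^+ m) l h = 0 by rewrite subr0.
    rewrite mxE big1 // => a _; have [->|/X0n_supp] := eqVneq ((X0 ^+ m) a h) 0.
      by rewrite mulr0.
    by rewrite /m; lia.
  have := glatM (glatX m hS) (hXn m); rewrite addrC depth0; exact.
have g1 : glat K false x 0 (g - 1%:M).
  have -> : 1%:M = \sum_(j < n.+1) X0 ^+ j * E * W ^+ j.
    rewrite (eq_bigr (fun j : 'I_n.+1 => X0 ^+ j * W ^+ j - X0 ^+ j.+1 * W ^+ j.+1)).
      rewrite -(big_mkord xpredT (fun j => X0 ^+ j * W ^+ j - X0 ^+ j.+1 * W ^+ j.+1)).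
      rewrite (telescope_sumr_eq (fun j => - (X0 ^+ j * W ^+ j))) //; last first.
        by move=> j _; rewrite opprK addrC.
      by rewrite X0n mul0r oppr0 sub0r opprK !expr0 mulr1.
    move=> j _; rewrite mulrBr mulr1 mulrBl; congr (_ - _).
    by rewrite exprSr exprS !mulrA.
  rewrite /g -sumrB; apply: glat_sum => j _.
  have -> : X ^+ j * U * W ^+ j - X0 ^+ j * E * W ^+ j =
      X ^+ j * (U - E) * W ^+ j + (X ^+ j - X0 ^+ j) * E * W ^+ j.
    by rewrite [_ * (U - E)]mulrBr !mulrBl addrA subrK.
  rewrite -(depth0 j); apply: glatD; apply: (glatM (b := false) (b' := true)).
  - by rewrite -[r *+ j]addr0; apply: (glatM (b := true) (b' := false)) => //; apply: glatX.
  - exact: glatX.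
  - by rewrite -[r *+ j]addr0; apply: (glatM (b := false) (b' := true)).
  - exact: glatX.
have pg := det_princ_unit g1.
have dg0 : \det g != 0 by apply: (int_unit_neq0 (R := R) (K := K)); exact: princ_unit_unit.
have ug : g \in unitmx by rewrite unitmxE unitfE.
(* Rescaling [g] brings its determinant to [1] without changing [Ad g]. *)
have [c hc] : exists c, c ^+ n.+1 = (\det g)^-1.
  apply: (@princ_unit_root R _ K); first by apply: (int_unit_nat char_p); rewrite n_lt_p.
  have := pg; rewrite /princ_unit => hp.
  have -> : (\det g)^-1 - 1 = - ((\det g)^-1 * (\det g - 1)) by rewrite mulrBr mulVf // mulr1 opprB.
  rewrite depN -[1]add0r; apply: (depM (b := true) (b' := true)) => //.
  exact/int_unit_dep/int_unitV/princ_unit_unit.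
have c0 : c != 0.
  by apply: contraNneq dg0 => e; rewrite -invr_eq0 -hc e expr0n.
exists (c *: g); first by rewrite /SL /= detZ hc mulVf.
rewrite /Ad invmxZ; last by rewrite unitmxE detZ unitrM unitrX ?unitfE // -unitmxE.
rewrite -!scalemxAl -!scalemxAr scalerA divff // scale1r.
by move: gX0; rewrite -mulmxE => <-; rewrite mulmxK.
Qed.

(** [W X0] is the projector onto the indices that are not the first of their
    block. *)
Lemma block_rank : (n.+1 <= #|[set: 'I_n.+1] :\: [set j | [exists i, nxt i j]]| + \rank X0)%N.
Proof.
set A := _ :\: _.
have e1 : 1%:M = (\sum_(j in A) delta_mx j j) + W *m X0.
  apply/matrixP => i j; rewrite mxE [RHS]mxE summxE [X in _ + X]WX0E.
  have [<-|ij] := eqVneq i j; last first.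
    rewrite andbF addr0 big1 // => l _; rewrite mxE.
    by have [<-|] := eqVneq i l; rewrite // eq_sym (negbTE ij).
  rewrite andbT; have [h|h] := boolP [exists i', nxt i' i].
    rewrite big1 ?add0r // => l; rewrite !inE => lA; rewrite mxE.
    by have [e|] := eqVneq i l; rewrite //= -e h in lA *.
  rewrite (bigD1 i) /= ?mxE ?eqxx ?inE ?h // big1 ?addr0 // => l /andP[_ li].
  by rewrite mxE eq_sym (negbTE li).
have e2 : (\rank (\sum_(j in A) delta_mx j j : 'M[k]_n.+1)%R <= #|A|)%N.
  rewrite -sum1_card; apply: (big_ind2 (fun (M : 'M[k]_n.+1) c => \rank M <= c)%N).
  - by rewrite mxrank0.
  - by move=> M c M' c' h h'; exact: (leq_trans (mxrank_add M M') (leq_add h h')).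
  - by move=> j _; rewrite mxrank_delta.
apply: (@leq_trans (\rank (1%:M : 'M[k]_n.+1))); first by rewrite mxrank1.
rewrite e1; apply: leq_trans (mxrank_add _ _) _; apply: leq_add e2 _; exact: mxrankM_maxr.
Qed.

Variable m : 'I_n.+1 -> nat.
Hypothesis m_nxt : forall i j, nxt i j -> m i = m j.
Hypothesis m_end : forall i, (forall j, ~~ nxt i j) -> m i = (off i).+1.

Let dg (f : 'I_n.+1 -> k) : 'M[k]_n.+1 := diag_mx (\row_i f i).
Let dg_mul f V i j : (dg f * V) i j = f i * V i j.
Proof. by rewrite -mulmxE mul_diag_mx !mxE. Qed.
Let mul_dg f V i j : (V * dg f) i j = V i j * f j.
Proof. by rewrite -mulmxE mul_mx_diag !mxE. Qed.

(** On a block of size [m], [X0 Y] and [Y X0] are the diagonal matrices with the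
    entries familiar from the irreducible representation of dimension [m]; they
    are integers, so the triple is as integral as [X0] and [W]. *)
Lemma block_triple : exists Y H, [/\ lie_triple Y H X0, glat K true x (- r) Y & glat K true x 0 H].
Proof.
pose o i : k := (off i)%:R.
pose C := dg (fun i => (o i + 1) * ((m i)%:R - 1 - o i)).
pose C' := dg (fun i => o i * ((m i)%:R - o i)).
pose H := dg (fun i => (m i)%:R - 1 - o i - o i).
have o_nxt i j : nxt i j -> o j = o i + 1.
  by move=> /off_nxt e; rewrite /o e -natr1.
have X0Y : X0 * (W * C) = C.
  apply/matrixP => i j; rewrite mulrA mul_dg X0WE [RHS]mxE mxE.
  have [<-|_] := eqVneq i j; last by rewrite andbF mul0r.
  rewrite andbT mulr1n; case: existsP => [_|h]; first by rewrite mul1r.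
  rewrite mul0r m_end; last by move=> j'; apply/negP => e; apply: h; exists j'.
  by rewrite -natr1 /o addrK subrr mulr0.
have CX0 : C * X0 = X0 * C'.
  apply/matrixP => i j; rewrite dg_mul mul_dg mxE.
  case e : (nxt i j); last by rewrite !mul0r mulr0.
  by rewrite (o_nxt _ _ e) (m_nxt e); ring.
have YX0 : (W * C) * X0 = C'.
  rewrite -mulrA CX0 mulrA; apply/matrixP => i j; rewrite mul_dg WX0E [RHS]mxE mxE.
  have [<-|_] := eqVneq i j; last by rewrite andbF mul0r.
  rewrite andbT mulr1n; case: existsP => [_|h]; first by rewrite mul1r.
  rewrite mul0r /o off0; first by rewrite mul0r.
  by move=> i'; apply/negP => e; apply: h; exists i'.
exists (W * C), H; split; first split.
- rewrite /lie mulmxE; apply/matrixP => i j.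
  rewrite submxE dg_mul mul_dg mulr2n [RHS]mxE !mxE.
  case e : (nxt i j); last by rewrite !mul0r mulr0 subrr addr0.
  by rewrite (o_nxt _ _ e) (m_nxt e); ring.
- rewrite /lie mulmxE; apply/matrixP => j i.
  rewrite submxE dg_mul !mul_dg mulr2n [RHS]mxE [X in _ = - X]mxE !mul_dg !mxE.
  case e : (nxt i j); last by rewrite !(mul0r, mulr0, subrr, addr0, oppr0).
  by rewrite (o_nxt _ _ e) (m_nxt e); ring.
- rewrite /lie mulmxE X0Y YX0; apply/matrixP => i j; rewrite submxE !mxE.
  case: (i == j); rewrite ?mulr0n ?subrr // !mulr1n; ring.
- move=> j i; rewrite mul_dg -[- r + _]addr0; apply: (depM (b := true) (b' := true)).
    exact: W_glat.
  rewrite -[0]addr0; apply: (depM (b := true) (b' := true)).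
    by apply: depD; rewrite ?dep1 //; apply: dep_nat.
  by apply: depB; last exact: dep_nat; apply: depB; rewrite ?dep1 //; apply: dep_nat.
- move=> i j; rewrite !mxE; have [<-|_] := eqVneq i j; last by rewrite mulr0n dep0.
  rewrite subrr addr0 mulr1n.
  by do 3 (apply: depB; rewrite ?dep1 ?dep_nat //).
Qed.

End Block.

(** * Affine roots of level r and the kernel of X *)

Section Components.
Context {R : realType} {n : nat}.
Implicit Types (x y : 'rV[R]_n) (r : R).

(** For [i <> j]: some affine root with gradient [e_i - e_j] takes the value [r]
    at [x]. *)
Definition arr r x : rel 'I_n := fun i j => (x 0 i - x 0 j - r) \is a Num.int.
Definition adj r x : rel 'I_n := fun i j => arr r x i j || arr r x j i.
Definition component r x : 'I_n -> 'I_n := fingraph.root (adj r x).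
Definition comps r x : {set 'I_n} := [set i | component r x i == i].
(** One more than the dimension of the [r]-facet of [x]; see [facet_dim]. *)
Definition ncomp r x : nat := #|comps r x|.

Lemma adj_sym r x : symmetric (adj r x).
Proof. by move=> i j; rewrite /adj orbC. Qed.

Lemma adj_csym r x : connect_sym (adj r x).
Proof. exact/sym_connect_sym/adj_sym. Qed.

Lemma componentE r x i j : (component r x i == component r x j) = connect (adj r x) i j.
Proof. by apply: fingraph.root_connect; exact: adj_csym. Qed.

Lemma comp_comps r x i : component r x i \in comps r x.
Proof. by rewrite inE /component fingraph.root_root //; exact: adj_csym. Qed.

Lemma arr_comp r x i j : arr r x i j -> component r x i = component r x j.
Proof. by move=> h; apply/eqP; rewrite componentE connect1 // /adj h. Qed.

Lemma dep_exact_arr {k : fieldType} (K : local_field k) r x i j a :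
  depth K true (r + (x 0 j - x 0 i)) a -> ~~ depth K false (r + (x 0 j - x 0 i)) a ->
  arr r x i j.
Proof.
move=> h1 h2; have [_ e] := dep_exact h1 h2.
rewrite /arr (_ : _ - r = - (vl K a)%:~R); last by rewrite e; lra.
by rewrite rpredN intr_int.
Qed.

End Components.

Section Upper.
Context {R : realType} {k : fieldType} (K : local_field k) {n : nat}.
Variables (p : nat) (char_p : p \in [pchar (residue K)]).
Hypotheses (n_lt_p : (n.+1 < p)%N) (p_gt2 : (2 < p)%N).
Implicit Types (y : 'rV[R]_n.+1) (X Y H : 'M[k]_n.+1).
Local Notation dep := (@depth R k K).

Lemma powers_support r y X m i l : glat K true y r X ->
  ~~ dep false (r *+ m + (y 0 i - y 0 l)) ((X ^+ m) l i) -> connect (adj r y) l i.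
Proof.
move=> hX; elim: m l => [|m IH] l.
  rewrite expr0 mxE; have [->|_] := eqVneq l i; first by rewrite connect0.
  by rewrite mulr0n dep0.
rewrite exprS mxE => h.
have [j hj] : exists j, ~~ dep false (r *+ m.+1 + (y 0 i - y 0 l)) (X l j * (X ^+ m) j i).
  apply/existsP; apply: contraNT h => /existsPn h; apply: dep_sum => j _.
  exact/negPn/h.
have e : r *+ m.+1 + (y 0 i - y 0 l) = (r + (y 0 j - y 0 l)) + (r *+ m + (y 0 i - y 0 j)).
  by rewrite mulrS; lra.
have hXm := glatX m hX j i.
apply: (@connect_trans _ _ j).
  apply: connect1; rewrite /adj (dep_exact_arr (hX l j)) //.
  by apply: contraNN hj => hj; rewrite e; apply: (depM hj hXm).
by apply: IH; apply: contraNN hj => hj; rewrite e; apply: (depM (hX l j) hj).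
Qed.

(** Each component contributes a vector to the kernel of [X]: the last nonzero
    image of a basis vector under the powers of the graded nilpotent map induced
    by [X], supported on the component, is lifted to the kernel by the projector
    [1 - S X]. *)
Lemma ncomp_rank r y Y H X : lie_triple Y H X ->
  glat K true y r X -> glat K true y (- r) Y -> (ncomp r y + \rank X <= n.+1)%N.
Proof.
move=> tr hX hY; have XN := triple_nilpotent (R := R) char_p n_lt_p p_gt2 tr.
have [S hS eS] := triple_pinv char_p n_lt_p p_gt2 tr hX hY.
have XSX : X * S * X = X by have := eS 1%N; rewrite !expr1.
(* The level at which [X ^ m] sends the basis vector [i]. *)
pose lev i m : R := r *+ m + y 0 i.
have /fin_all_exists[lv hlv] : forall i : 'I_n.+1, exists m : nat,
    (exists l, ~~ dep false (lev i m - y 0 l) ((X ^+ m) l i)) /\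
    (forall l, dep false (lev i m.+1 - y 0 l) ((X ^+ m.+1) l i)).
  move=> i.
  pose P m := [exists l, ~~ dep false (lev i m - y 0 l) ((X ^+ m) l i)].
  have exP : exists m, P m.
    exists 0%N; apply/existsP; exists i.
    by rewrite /lev mulr0n add0r subrr expr0 mxE eqxx dep1F.
  have ubP m : P m -> (m <= n)%N.
    move=> /existsP[l]; apply: contraNT; rewrite -ltnNge => nm.
    have -> : X ^+ m = 0 by rewrite -(subnK nm) exprD XN mulr0.
    by rewrite mxE dep0.
  case: (ex_maxnP exP ubP) => m /existsP hm hmax; exists m; split => // l.
  apply/negPn/negP => h; have := hmax m.+1; rewrite ltnn => /(_ _)/negP.
  by apply; last (by []); apply/existsP; exists l.
pose sg i := lev i (lv i).
pose V i l := ((1 - S * X) * X ^+ lv i) l i.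
have Xlv i l : dep true (sg i - y 0 l) ((X ^+ lv i) l i).
  by have := glatX (lv i) hX l i; apply: depW => /=; rewrite /sg /lev; lra.
have hV i l : dep false (sg i - y 0 l) (V i l - (X ^+ lv i) l i).
  have -> : V i l - (X ^+ lv i) l i = - \sum_h S l h * (X ^+ (lv i).+1) h i.
    have -> : \sum_h S l h * (X ^+ (lv i).+1) h i = (S * X ^+ (lv i).+1) l i by rewrite [RHS]mxE.
    rewrite exprS mulrA /V mulrBl mul1r.
    by rewrite submxE addrAC subrr add0r.
  rewrite depN; apply: dep_sum => h _.
  have -> : sg i - y 0 l = (- r + (y 0 h - y 0 l)) + (lev i (lv i).+1 - y 0 h).
    by rewrite /sg /lev mulrS; lra.
  exact: (depM (hS l h) ((hlv i).2 h)).
have VE i l : dep false (sg i - y 0 l) (V i l) = dep false (sg i - y 0 l) ((X ^+ lv i) l i).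
  have e : V i l = (X ^+ lv i) l i + (V i l - (X ^+ lv i) l i) by rewrite addrC subrK.
  by rewrite e depDr.
have Vt i l : dep true (sg i - y 0 l) (V i l).
  by rewrite -[V i l](subrK ((X ^+ lv i) l i)); apply: depD => //; apply: dep_ge (hV i l).
have Vsupp i l : ~~ dep false (sg i - y 0 l) (V i l) -> connect (adj r y) l i.
  rewrite VE => h; apply: (@powers_support r y X (lv i)) => //.
  by apply: contraNN h; apply: depW; rewrite /= /sg /lev; lra.
pose U : 'M[k]_(n.+1, ncomp r y) := \matrix_(l, c) V (enum_val c) l.
have XU : X *m U = 0.
  apply/matrixP => a c; rewrite [RHS]mxE.
  have -> : (X *m U) a c = (X * ((1 - S * X) * X ^+ lv (enum_val c))) a (enum_val c).
    by rewrite [LHS]mxE [RHS]mxE; apply: eq_bigr => l _; rewrite [X in _ * X]mxE.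
  by rewrite mulrA mulrBr mulr1 mulrA XSX subrr mul0r mxE.
have := mulmx0_rank_max XU; rewrite addnC.
suff : row_free U^T by rewrite /row_free mxrank_tr => /eqP ->.
apply: inj_row_free => v vU; apply/eqP/negPn/negP => v0.
have [c0 hc0] : exists c, v 0 c != 0.
  apply/existsP; apply: contraNT v0 => /existsPn h; apply/eqP/rowP => c.
  by rewrite mxE; apply/eqP/negPn/h.
(* In a linear relation, the columns of least level cannot cancel: at an entry
   where one of them is exact, those of other components lie in an open ideal. *)
pose f c : R := (vl K (v 0 c))%:~R + sg (enum_val c).
have [c vc hmin] := @Order.TotalTheory.arg_minP _ _ _ c0 (fun c => v 0 c != 0) f hc0.
have [l hl] := (hlv (enum_val c)).1; rewrite -VE in hl.
have /eqP : (v *m U^T) 0 l = 0 by rewrite vU mxE.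
rewrite mxE (bigD1 c) //= => /eqP e.
have : dep false (f c - y 0 l) (v 0 c * U^T c l).
  have -> : v 0 c * U^T c l = - \sum_(i | i != c) v 0 i * U^T i l.
    by apply/eqP; rewrite -addr_eq0 e.
  rewrite depN; apply: dep_sum => i ic; rewrite !mxE.
  have [->|vi] := eqVneq (v 0 i) 0; first by rewrite mul0r dep0.
  have := hmin i vi; rewrite /f => le.
  have hV0 : dep false (sg (enum_val i) - y 0 l) (V (enum_val i) l).
    apply/negPn/negP => /Vsupp; rewrite -componentE => /eqP e1.
    move/Vsupp: hl; rewrite -componentE e1.
    have := enum_valP i; have := enum_valP c; rewrite !inE => /eqP -> /eqP ->.
    by rewrite (inj_eq enum_val_inj) (negbTE ic).
  by apply: depW (depM (dep_vl K (v 0 i)) hV0) => /=; move: le; rewrite /f; lra.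
rewrite !mxE => h; move: hl => /negP; apply.
by apply: (depMF vc erefl); apply: depW h => /=; rewrite /f; lra.
Qed.

End Upper.

(** * Conjugation invariance of the number of components *)

Section Lower.
Context {R : realType} {k : fieldType} (K : local_field k) {n : nat}.
Variables (p : nat) (char_p : p \in [pchar (residue K)]).
Hypothesis (n_lt_p : (n < p)%N).
Implicit Types (x y : 'rV[R]_n) (g Z : 'M[k]_n) (r s : R).
Local Notation dep := (@depth R k K).
Local Notation glat := (@glat R k K n).

Definition same_lat x y g r : Prop :=
  forall b Z, glat b x r Z <-> glat b y r (Ad g Z).

Lemma same_lat_sym x y g r : g \in unitmx -> same_lat x y g r -> same_lat y x (invmx g) r.
Proof. by move=> ug h b Z; rewrite h AdVK. Qed.

Lemma same_lat_dual x y g r : g \in unitmx -> same_lat x y g r -> same_lat x y g (- r).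
Proof.
move=> ug h.
suff main x' y' g' : g' \in unitmx -> same_lat x' y' g' r -> forall b Z,
    glat b x' (- r) Z -> glat b y' (- r) (Ad g' Z).
  move=> b Z; split=> [|h']; first exact: main.
  rewrite -(AdK Z ug); apply: main h'; rewrite ?unitmx_inv //.
  exact: same_lat_sym.
move=> ug' h' b Z; rewrite -[b]negbK => hZ; apply/glat_dual => W hW.
have := (glat_dual _ _ _ _ _).1 hZ (Ad (invmx g') W); rewrite h' AdVK // => /(_ hW).
by rewrite -(Ad_tr _ ug') AdMM // AdVK.
Qed.

Lemma arrN r x i j : arr (- r) x i j = arr r x j i.
Proof.
by rewrite /arr -rpredN (_ : - (_ - _) = x 0 j - x 0 i - r) //; lra.
Qed.

(** The indices involved in some affine root of level [r]; each of the others is a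
    component by itself.  The pair [(i, i)] counts when [r] is an integer, which
    accounts for the torus. *)
Definition linked r x : {set 'I_n} := [set i | [exists j, adj r x i j]].

Lemma linkedN r x : linked (- r) x = linked r x.
Proof.
by apply/finset.setP => i; rewrite !inE; apply: eq_existsb => j; rewrite /adj !arrN orbC.
Qed.

Definition arr_closed r x (S : {set 'I_n}) : Prop :=
  forall i j, arr r x i j -> (i \in S) = (j \in S).

Lemma arr_closedN r x S : arr_closed r x S -> arr_closed (- r) x S.
Proof. by move=> h i j; rewrite arrN => /h ->. Qed.

Lemma linked_closed r x : arr_closed r x (linked r x).
Proof.
move=> i j h; rewrite !inE; transitivity true; first by apply/existsP; exists j; rewrite /adj h.
by apply/esym/existsP; exists i; rewrite /adj h orbT.
Qed.

Lemma glat_exact_arr s y Z i j : glat true y s Z ->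
  ~~ dep false (s + (y 0 j - y 0 i)) (Z i j) -> arr s y i j.
Proof.
by move=> hZ; exact: dep_exact_arr.
Qed.

Lemma glat_unlinked s y Z i j : glat true y s Z -> (i \notin linked s y) || (j \notin linked s y) ->
  dep false (s + (y 0 j - y 0 i)) (Z i j).
Proof.
move=> hZ h; apply/negPn/negP => /(glat_exact_arr hZ) a; move: h.
rewrite !inE -negb_and => /negP; apply; apply/andP; split; apply/existsP.
  by exists j; rewrite /adj a.
by exists i; rewrite /adj a orbT.
Qed.

Lemma arr_elt s y i j : arr s y i j -> exists2 a : k, a != 0 & (vl K a)%:~R = s + (y 0 j - y 0 i).
Proof.
move=> /intrP[m hm]; have [a a0 va] := vl_surj K (- m).
by exists a => //; rewrite va mulrNz -hm; lra.
Qed.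

Lemma glat_delta b s y i j a : dep b (s + (y 0 j - y 0 i)) a -> glat b y s (a *: delta_mx i j).
Proof.
move=> h i' j'; rewrite !mxE; have [->|_] := eqVneq i' i; last by rewrite mulr0 dep0.
by have [->|_] := eqVneq j' j; rewrite ?mulr0 ?dep0 // mulr1.
Qed.

Definition idem (S : {set 'I_n}) : 'M[k]_n := \matrix_(i, j) ((i == j) && (i \in S))%:R.

Lemma idem_tr S : \tr (idem S) = #|S|%:R.
Proof.
rewrite -sum1_card natr_sum big_mkcond; apply: eq_bigr => i _.
by rewrite mxE eqxx; case: (i \in S).
Qed.

Lemma mul_idem S Z i j : (idem S *m Z) i j = (i \in S)%:R * Z i j.
Proof.
rewrite mxE (bigD1 i) //= mxE eqxx big1 ?addr0 // => l li.
by rewrite mxE eq_sym (negbTE li) mul0r.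
Qed.

Lemma mul_idemr S Z i j : (Z *m idem S) i j = (j \in S)%:R * Z i j.
Proof.
rewrite mxE (bigD1 j) //= mxE eqxx big1 ?addr0 => [|l lj]; first exact: mulrC.
by rewrite mxE (negbTE lj) mulr0.
Qed.

Lemma idemI S T : idem S *m idem T = idem (S :&: T).
Proof.
apply/matrixP => i j; rewrite mul_idem !mxE inE.
by case: (i == j); case: (i \in S); case: (i \in T); rewrite /= ?mulr1 ?mulr0.
Qed.

Lemma idem_sum S : idem S = \sum_(i in S) delta_mx i i.
Proof.
apply/matrixP => i j; rewrite mxE summxE.
have [iS|iS] := boolP (i \in S); last first.
  rewrite andbF big1 // => l lS; rewrite mxE.
  by case: eqVneq => [e|]; rewrite //= ; rewrite e lS in iS.
rewrite (bigD1 i) //= mxE eqxx /= andbT big1 ?addr0 // => [|l /andP[_ li]].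
  by rewrite eq_sym.
by rewrite mxE eq_sym (negbTE li).
Qed.

Section OneIdem.
Variables (x y : 'rV[R]_n) (g : 'M[k]_n) (r : R).
Hypotheses (ug : g \in unitmx) (hg : same_lat x y g r).
Variable S : {set 'I_n}.
Hypotheses (SN : S \subset linked r x) (Scl : arr_closed r x S).

Let e' := Ad g (idem S).
Let pm (s : R) := s = r \/ s = - r.

Let hg' s : pm s -> same_lat x y g s.
Proof. by case=> ->; [exact: hg|exact: same_lat_dual]. Qed.

Let pmN s : pm s -> pm (- s).
Proof. by case=> ->; [right|left; rewrite opprK]. Qed.

Let linked_pm s z : pm s -> linked s z = linked r z.
Proof. by case=> ->; rewrite ?linkedN. Qed.

Let linked_arr z i : i \in linked r z -> exists s j, pm s /\ arr s z i j.
Proof.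
rewrite inE => /existsP[j /orP[h|h]]; first by exists r, j; split; first by left.
by exists (- r), j; split; [right|rewrite arrN].
Qed.

(** The elementary matrix [E_ll] of a linked index [l] is the product of a matrix
    of depth [s] and one of depth [- s] with [s = r] or [s = - r], so its conjugate
    is controlled by these lattices, although nothing is known in depth [0]. *)
Let e'_integral i j : dep true (y 0 j - y 0 i) (e' i j) /\
  ((i \notin linked r y) || (j \notin linked r y) -> dep false (y 0 j - y 0 i) (e' i j)).
Proof.
suff h b : b || (i \notin linked r y) || (j \notin linked r y) -> dep b (y 0 j - y 0 i) (e' i j).
  by split=> [|h']; [exact: (h true)|exact: (h false)].
move=> hb; rewrite /e' idem_sum.
have -> : Ad g (\sum_(l in S) delta_mx l l) = \sum_(l in S) Ad g (delta_mx l l).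
  apply: (big_morph (Ad g)) => [Z Z'|]; first exact: AdD.
  by rewrite /Ad mulmx0 mul0mx.
rewrite summxE; apply: dep_sum => l lS.
have [s [m [ps am]]] := linked_arr (fintype.subsetP SN l lS).
have [a a0 va] := arr_elt am.
have h1 : glat true x s (a *: delta_mx l m) by apply: glat_delta; rewrite -va; exact: dep_vl.
have h2 : glat true x (- s) (a^-1 *: delta_mx m l).
  apply: glat_delta; rewrite (_ : _ + _ = (vl K a^-1)%:~R); first exact: dep_vl.
  by rewrite vlV mulrNz va; lra.
have -> : delta_mx l l = (a *: delta_mx l m) *m (a^-1 *: delta_mx m l) :> 'M[k]_n.
  by rewrite -scalemxAl -scalemxAr scalerA divff // scale1r mul_delta_mx.
rewrite AdMM // mxE; apply: dep_sum => h _.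
have /(hg' ps) g1 := h1; have /(hg' (pmN ps)) g2 := h2.
have -> : y 0 j - y 0 i = (s + (y 0 h - y 0 i)) + (- s + (y 0 j - y 0 h)) by lra.
case/orP: hb => [/orP[->|hi]|hj]; first exact: (depM (g1 _ _) (g2 _ _)).
  apply: depFW; apply: (depM (b := false) (b' := true)) => //.
  by apply: glat_unlinked => //; rewrite linked_pm // hi.
apply: depFW; apply: (depM (b := true) (b' := false)) => //.
by apply: glat_unlinked => //; rewrite linked_pm ?hj ?orbT //; exact: pmN.
Qed.

(** At [x], the commutator with [idem S] only retains the entries between [S] and
    its complement, which carry no affine root of level [s]. *)
Let lie_e' s Z : pm s -> glat true y s Z -> glat false y s (lie e' Z).
Proof.
move=> ps hZ; rewrite -[Z](AdVK _ ug) /e' -Ad_lie //; apply/hg' => //.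
have {hZ} : glat true x s (Ad (invmx g) Z) by apply/hg'; rewrite ?AdVK.
set W := Ad _ Z => hW i j.
have -> : lie (idem S) W i j = ((i \in S)%:R - (j \in S)%:R) * W i j.
  by rewrite /lie mxE [(- (_ *m _)) i j]mxE mul_idem mul_idemr mulrBl.
have [e|ne] := eqVneq (i \in S) (j \in S); first by rewrite e subrr mul0r dep0.
rewrite -[s + _]add0r; apply: (depM (b := true) (b' := false)).
  by apply: depB; apply: dep_nat.
apply/negPn/negP => /(glat_exact_arr hW) a; move: ne.
have Sc : arr_closed s x S by case: ps => ->; [exact: Scl|exact: arr_closedN].
by rewrite (Sc _ _ a) eqxx.
Qed.

Let e'_arr s i j : pm s -> arr s y i j ->
  (forall l, l != i -> dep false (y 0 i - y 0 l) (e' l i)) /\ dep false 0 (e' i i - e' j j).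
Proof.
move=> ps aij; have [a a0 va] := arr_elt aij.
have hZ : glat true y s (a *: delta_mx i j) by apply: glat_delta; rewrite -va; exact: dep_vl.
have L l : lie e' (a *: delta_mx i j) l j = a * (e' l i - (l == i)%:R * e' j j).
  have -> : lie e' (a *: delta_mx i j) = a *: (e' *m delta_mx i j - delta_mx i j *m e').
    by rewrite /lie -scalemxAr -scalemxAl scalerBr.
  rewrite [LHS]mxE; congr (_ * _); rewrite [LHS]mxE; congr (_ + _).
    rewrite [LHS]mxE (bigD1 i) //= [X in _ * X]mxE !eqxx mulr1 big1 ?addr0 // => h hi.
    by rewrite [X in _ * X]mxE (negbTE hi) mulr0.
  rewrite [LHS]mxE; congr (- _); rewrite [LHS]mxE (bigD1 j) //= mxE eqxx andbT.
  by rewrite big1 ?addr0 // => h hj; rewrite mxE (negbTE hj) andbF mul0r.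
have D l : dep false (y 0 i - y 0 l) (e' l i - (l == i)%:R * e' j j).
  apply: (depMF a0 va); rewrite -L (_ : _ + _ = s + (y 0 j - y 0 l)); last by lra.
  exact: lie_e'.
split=> [l li|]; first by have := D l; rewrite (negbTE li) mul0r subr0.
by have := D i; rewrite eqxx mul1r subrr.
Qed.

Lemma idem_off i j : i != j -> dep false (y 0 j - y 0 i) (e' i j).
Proof.
move=> ij; have [jN|jN] := boolP (j \in linked r y); last first.
  by apply: (e'_integral i j).2; rewrite jN orbT.
have [s [l [ps a]]] := linked_arr jN.
by have [h _] := e'_arr ps a; exact: h.
Qed.

Lemma idem_int i : dep true 0 (e' i i).
Proof. by have := (e'_integral i i).1; rewrite subrr. Qed.

(** The reduction of [Ad g (idem S)] is the diagonal idempotent of this set. *)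
Definition transported : {set 'I_n} := [set i | ~~ dep false 0 (e' i i)].

Lemma transported_linked : transported \subset linked r y.
Proof.
apply/fintype.subsetP => i; rewrite inE; apply: contraNT => h.
by have := (e'_integral i i).2; rewrite h subrr => ->.
Qed.

Lemma transported_closed : arr_closed r y transported.
Proof.
move=> i j a; rewrite !inE; have [_ d] := e'_arr (or_introl erefl) a.
by rewrite -(subrK (e' j j) (e' i i)) addrC depDr.
Qed.

(** Modulo the maximal ideal, the diagonal entries of the conjugate idempotent are
    [0] or [1] and their sum is its trace. *)
Lemma card_transported : #|transported| = #|S|.
Proof.
apply: (dep_nat_eq (R := R) char_p).
- by apply: leq_ltn_trans (max_card _) _; rewrite card_ord.
- by apply: leq_ltn_trans (max_card _) _; rewrite card_ord.
rewrite -opprB depN -(idem_tr S) -(Ad_tr _ ug) -sum1_card natr_sum big_mkcond -sumrB.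
apply: dep_sum => i _; rewrite inE.
have [h|h] := boolP (dep false 0 (e' i i)); first by rewrite /= subr0.
have u : int_unit (R := R) K (e' i i) by rewrite /int_unit idem_int h.
have u0 := int_unit_neq0 u; have vu : vl K (e' i i) = 0.
  by move: u; rewrite int_unitE => /andP[_ /eqP].
apply: (depMF u0 (s := 0)); first by rewrite vu.
have -> : Ad g (idem S) i i * (Ad g (idem S) i i - 1) = - \sum_(l | l != i) e' i l * e' l i.
  have : (e' *m e') i i = e' i i by rewrite /e' -AdMM // idemI finset.setIid.
  by rewrite mxE (bigD1 i) //= => e; rewrite mulrBr mulr1 -{3}e -/e' opprD addNKr.
rewrite depN; apply: dep_sum => l li.
have -> : 0 + 0 = (y 0 l - y 0 i) + (y 0 i - y 0 l) by lra.
by apply: (depM (b := false) (b' := false)); apply: idem_off; rewrite // eq_sym.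
Qed.

End OneIdem.

Lemma transported_disjoint x y g r (S T : {set 'I_n}) : g \in unitmx -> same_lat x y g r ->
  S \subset linked r x -> arr_closed r x S -> T \subset linked r x -> arr_closed r x T ->
  S :&: T = finset.set0 -> transported g S :&: transported g T = finset.set0.
Proof.
move=> ug hg SN Sc TN Tc dST; apply/finset.setP => i; rewrite !inE.
apply/negP => /andP[hS]; apply/negP; rewrite negbK.
have u : int_unit (R := R) K (Ad g (idem S) i i) by rewrite /int_unit (idem_int ug hg SN).
have u0 := int_unit_neq0 u; have vu : vl K (Ad g (idem S) i i) = 0.
  by move: u; rewrite int_unitE => /andP[_ /eqP].
apply: (depMF u0 (s := 0)); first by rewrite vu.
have -> : Ad g (idem S) i i * Ad g (idem T) i i =
    - \sum_(l | l != i) Ad g (idem S) i l * Ad g (idem T) l i.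
  have : (Ad g (idem S) *m Ad g (idem T)) i i = 0.
    rewrite -AdMM // idemI dST.
    rewrite (_ : idem _ = 0); first by rewrite /Ad mulmx0 mul0mx mxE.
    by apply/matrixP => a b; rewrite !mxE inE andbF.
  by rewrite mxE (bigD1 i) //= => /eqP; rewrite addr_eq0 => /eqP.
rewrite depN; apply: dep_sum => l li.
have -> : 0 + 0 = (y 0 l - y 0 i) + (y 0 i - y 0 l) by lra.
by apply: (depM (b := false) (b' := false));
  [apply: (idem_off ug hg SN)|apply: (idem_off ug hg TN)]; rewrite // eq_sym.
Qed.

Lemma card_linked x y g r : g \in unitmx -> same_lat x y g r ->
  (#|linked r x| <= #|linked r y|)%N.
Proof.
move=> ug hg; have lc := @linked_closed r x.
rewrite -(card_transported ug hg (fintype.subxx _) lc); apply: subset_leq_card.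
exact: (transported_linked ug hg).
Qed.

Definition comp_class r x c : {set 'I_n} := [set i | component r x i == c].

Lemma comp_closed r x c : arr_closed r x (comp_class r x c).
Proof. by move=> i j /arr_comp e; rewrite !inE e. Qed.

Lemma closed_comp r x (S : {set 'I_n}) i j : arr_closed r x S ->
  component r x i = component r x j -> (i \in S) = (j \in S).
Proof.
move=> Sc /eqP; rewrite componentE; apply: closed_connect => {}i {}j /orP[|] /Sc -> //.
Qed.

Lemma unlinked_comp r x i : i \notin linked r x -> component r x i = i.
Proof.
move=> iN; have : connect (adj r x) i (component r x i).
  by rewrite -componentE; have := comp_comps r x i; rewrite inE eq_sym.
move=> /connectP[[|j l] /= hp e]; first by rewrite {1}e.
case/andP: hp => hp _.
by move: iN; rewrite inE => /existsP[]; exists j.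
Qed.

Lemma comp_linked r x i : (component r x i \in linked r x) = (i \in linked r x).
Proof.
apply: (closed_comp (@linked_closed r x)).
by have := comp_comps r x i; rewrite inE => /eqP.
Qed.

Lemma ncompE r x : ncomp r x = (#|comps r x :&: linked r x| + (n - #|linked r x|))%N.
Proof.
rewrite /ncomp -(cardsID (linked r x)); congr (_ + _)%N.
rewrite -[X in (X - _)%N]card_ord -(finset.cardsC (linked r x)) addKn; apply: eq_card => i; rewrite !inE.
have := @unlinked_comp r x i; rewrite inE.
by case: [exists _, _] => //= ->; rewrite ?eqxx.
Qed.

(** Distinct components among the linked indices of [x] give disjoint nonempty
    unions of such components at [y], and the unlinked indices, each of which is a
    component, are at least as numerous at [y], by [card_linked] for the inverse
    of [g]. *)
Lemma ncomp_le x y g r : g \in unitmx -> same_lat x y g r -> (ncomp r x <= ncomp r y)%N.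
Proof.
move=> ug hg; rewrite !ncompE; apply: leq_add; last first.
  apply: leq_sub2l; apply: (@card_linked y x (invmx g)); first by rewrite unitmx_inv.
  exact: same_lat_sym.
pose S c := comp_class r x c.
have SN c : c \in linked r x -> S c \subset linked r x.
  by move=> cl; apply/fintype.subsetP => i; rewrite inE -comp_linked => /eqP ->.
have Scl c : arr_closed r x (S c) by exact: comp_closed.
have pick_ex c : exists i, (c \in comps r x :&: linked r x) ==> (i \in transported g (S c)).
  have [cl|_] := boolP (c \in comps r x :&: linked r x); last by exists c.
  move: cl; rewrite finset.in_setI => /andP[cc cl].
  have : (0 < #|transported g (S c)|)%N.
    rewrite (card_transported ug hg (SN c cl) (Scl c)); apply/card_gt0P; exists c.
    by move: cc; rewrite !inE.
  by move=> /card_gt0P[i hi]; exists i.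
have /fin_all_exists[f hf] := pick_ex.
rewrite -(card_in_imset (f := fun c => component r y (f c)) (D := mem (comps r x :&: linked r x))).
  apply: subset_leq_card; apply/fintype.subsetP => _ /imsetP[c hc ->].
  rewrite inE comp_comps comp_linked /=; have := hf c; rewrite hc /=.
  move: hc; rewrite finset.in_setI => /andP[_ cl].
  exact/fintype.subsetP/(transported_linked ug hg (SN c cl)).
move=> c c' hc hc' e; apply/eqP/negPn/negP => ne.
have := hf c; have := hf c'; rewrite hc hc' /=.
move: hc hc'; rewrite !finset.in_setI => /andP[_ cl] /andP[_ cl'].
rewrite -(closed_comp (transported_closed ug hg (Scl c')) e) => h1 h2.
have : S c :&: S c' = finset.set0.
  apply/finset.setP => i; rewrite !inE.
  by apply/negP => /andP[/eqP -> /eqP h]; rewrite h eqxx in ne.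
move=> /(transported_disjoint ug hg (SN c cl) (Scl c) (SN c' cl') (Scl c')).
by move=> /finset.setP/(_ (f c)); rewrite finset.in_setI h1 h2 inE.
Qed.

End Lower.

(** * Dimension of affine hulls *)

Section AffineDim.
Context {R : realType} {n : nat}.
Implicit Types (x y : 'rV[R]_n.+1) (r : R) (w : 'rV[R]_n.+1).

Let class_mx r x : 'M[R]_(ncomp r x, n.+1) :=
  \matrix_(c, i) (component r x i == enum_val c)%:R.

Let const_on r x : {vspace 'rV[R]_n.+1} := limg (linfun (mulmxr (class_mx r x))).
Let sum_fun : 'Hom('rV[R]_n.+1, 'rV[R]_1) := linfun (mulmxr (const_mx 1)).

(** The directions along which no affine root taking the value [r] at [x] varies. *)
Definition facet_dir r x : {vspace 'rV[R]_n.+1} := (const_on r x :&: lker sum_fun)%VS.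

Let sum_funE w : sum_fun w = (\sum_i w 0 i)%:M.
Proof.
rewrite lfunE /=; apply/matrixP => i j; rewrite !mxE !ord1 eqxx mulr1n.
by apply: eq_bigr => l _; rewrite mxE mulr1.
Qed.

Let class_mxE r x (v : 'rV[R]_(ncomp r x)) (F : 'I_n.+1 -> R) i :
  (forall c, v 0 c = F (enum_val c)) -> (v *m class_mx r x) 0 i = F (component r x i).
Proof.
move=> hv; rewrite mxE.
rewrite (eq_bigr (fun c => F (enum_val c) * (component r x i == enum_val c)%:R)); last first.
  by move=> c _; rewrite mxE hv.
rewrite -(big_enum_val (A := mem (comps r x)) (fun j => F j * (component r x i == j)%:R)) /=.
rewrite (bigD1 (component r x i)) /=; last exact: comp_comps.
by rewrite eqxx mulr1 big1 ?addr0 // => j /andP[_]; rewrite eq_sym => /negbTE ->; rewrite mulr0.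
Qed.

Let mem_const_on r x w : w \in const_on r x <-> forall i j, arr r x i j -> w 0 i = w 0 j.
Proof.
split.
  move=> /memv_imgP[v _ ->] i j /arr_comp e; rewrite lfunE /= !mxE.
  by apply: eq_bigr => c _; rewrite !mxE e.
move=> hw; have hc i : w 0 (component r x i) = w 0 i.
  have : connect (adj r x) i (component r x i).
    by rewrite -componentE; have := comp_comps r x i; rewrite inE eq_sym.
  move=> /connectP[l + ->]; elim: l i => [|j l IH] i //= /andP[h /IH ->].
  by case/orP: h => /hw ->.
apply/memv_imgP; exists (\row_c w 0 (enum_val c)); first exact: memvf.
rewrite lfunE /=; apply/rowP => i.
by rewrite (@class_mxE _ _ _ (fun j => w 0 j)) ?hc // => c; rewrite mxE.
Qed.

Lemma mem_facet_dir r x w : w \in facet_dir r x <->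
  \sum_i w 0 i = 0 /\ forall i j, arr r x i j -> w 0 i = w 0 j.
Proof.
rewrite memv_cap; split.
  move=> /andP[/mem_const_on h]; rewrite memv_ker sum_funE => /eqP/matrixP/(_ 0 0).
  by rewrite !mxE eqxx mulr1n => h0; split.
move=> [h0 /mem_const_on ->]; rewrite memv_ker sum_funE h0.
by rewrite (_ : 0%:M = 0) ?eqxx //; apply/matrixP => i j; rewrite !mxE mul0rn.
Qed.

Lemma dim_facet_dir r x : (\dim (facet_dir r x)).+1 = ncomp r x.
Proof.
have dimU : \dim (const_on r x) = ncomp r x.
  rewrite limg_dim_eq ?dimvf /dim /= ?mul1n //.
  apply/eqP; rewrite -subv0; apply/subvP => v; rewrite memv_cap => /andP[_].
  rewrite memv_ker lfunE /= memv0 => /eqP/rowP h; apply/eqP/rowP => c; rewrite mxE.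
  have := h (enum_val c).
  rewrite (@class_mxE _ _ _ (fun j => v 0 (enum_rank_in (enum_valP c) j))) ?mxE; last first.
    by move=> c'; rewrite enum_valK_in.
  by have := enum_valP c; rewrite inE => /eqP ->; rewrite enum_valK_in.
rewrite -dimU -(limg_ker_dim sum_fun (const_on r x)) -addn1 -/(facet_dir r x); congr (_ + _)%N.
apply/esym/eqP; rewrite eqn_leq; apply/andP; split.
  by apply: leq_trans (dimvS (subvf _)) _; rewrite dimvf /dim /= mul1n.
rewrite lt0n dimv_eq0; apply/eqP => h0.
have : sum_fun (const_mx 1) \in (sum_fun @: const_on r x)%VS.
  by apply/memv_img/mem_const_on => i j _; rewrite !mxE.
rewrite h0 memv0 sum_funE => /eqP/matrixP/(_ 0 0); rewrite !mxE eqxx mulr1n => /eqP.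
by rewrite (eq_bigr (fun=> 1)) => [|i _]; rewrite ?mxE // sumr_const card_ord pnatr_eq0.
Qed.

(** As soon as [S] contains [y] and one further point in each direction of [W], an
    affine space containing [S] contains [y + W]. *)
Lemma aff_dimE (S : set 'rV[R]_n.+1) y (W : {vspace 'rV[R]_n.+1}) :
  S y -> S `<=` aff_space y W -> aff_space y W `<=` apartment ->
  (forall w, w \in W -> exists2 e : R, e != 0 & S (y + e *: w)) -> aff_dim S = \dim W.
Proof.
move=> Sy SW Wapt hW.
have minW x1 W1 : S `<=` aff_space x1 W1 -> aff_space y W `<=` aff_space x1 W1.
  move=> S1 z hz; have [e e0 he] := hW _ hz.
  have h1 := S1 _ Sy; have h2 := S1 _ he; rewrite /aff_space /= in h1 h2 *.
  have : e *: (z - y) \in W1.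
    have -> : e *: (z - y) = (y + e *: (z - y) - x1) - (y - x1).
      by rewrite opprB addrA subrK addrAC subrr add0r.
    exact: rpredB.
  move=> /(memvZ e^-1); rewrite scalerA mulVf // scale1r => h3.
  by rewrite -(subrK y z) -addrA rpredD.
rewrite /aff_dim; apply: xget_unique.
  by exists y, W; split => // x1 W1 h1 _; exact: minW.
move=> d [x0 [W' [S' apt' min' ->]]].
have s1 : aff_space x0 W' `<=` aff_space y W by apply: min'.
have s2 : aff_space y W `<=` aff_space x0 W' by apply: minW.
suff -> : W' = W by [].
have hy : y - x0 \in W' by apply: s2; rewrite /aff_space /= subrr mem0v.
have hx : x0 - y \in W by apply: s1; rewrite /aff_space /= subrr mem0v.
apply/eqP; rewrite eqEsubv; apply/andP; split; apply/subvP => w hw.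
  have : aff_space y W (x0 + w) by apply: s1; rewrite /aff_space /= addrAC subrr add0r.
  by rewrite /aff_space /= addrAC => h; rewrite -(addKr (x0 - y) w) rpredD ?rpredN.
have : aff_space x0 W' (y + w) by apply: s2; rewrite /aff_space /= addrAC subrr add0r.
by rewrite /aff_space /= addrAC => h; rewrite -(addKr (y - x0) w) rpredD ?rpredN.
Qed.

End AffineDim.

(** * Hyperplanes of level r and small displacements *)

Section Perturbation.
Context {R : realType}.

Lemma away_from_int (a : R) : exists2 dl : R, 0 < dl & forall m : int,
  (0 < a + m%:~R -> dl <= a + m%:~R) /\ (a + m%:~R < 0 -> a + m%:~R <= - dl).
Proof.
have fl := floor_le a; have fg := floorD1_gt a; rewrite intrD /= in fg.
have lem (m : int) : (m <= - Num.floor a - 1) || (m >= - Num.floor a) by lia.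
have lem' (m : int) : (m <= - Num.floor a - 1) || (m == - Num.floor a) || (m >= - Num.floor a + 1) by lia.
have [e|ne] := eqVneq a (Num.floor a)%:~R.
  exists 1 => // m; case/orP: (lem' m) => [/orP[h|/eqP ->]|h].
  - by move: h; rewrite -(ler_int R) !intrD !intrN /=; lra.
  - by rewrite intrN; lra.
  - by move: h; rewrite -(ler_int R) !intrD !intrN /=; lra.
have lt : (Num.floor a)%:~R < a by rewrite lt_neqAle eq_sym ne fl.
exists (Num.min (a - (Num.floor a)%:~R) ((Num.floor a)%:~R + 1 - a)).
  by rewrite lt_min; apply/andP; split; lra.
move=> m; split=> h; last rewrite lerNr; rewrite ge_min; case/orP: (lem m) => h';
  move: h'; rewrite -(ler_int R) ?intrD !intrN /= => h'; apply/orP.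
- by exfalso; lra.
- by left; lra.
- by right; lra.
- by exfalso; lra.
Qed.

Lemma common_radius (I : finType) (P : I -> R -> Prop) :
  (forall i (e e' : R), 0 < e' -> e' <= e -> P i e -> P i e') ->
  (forall i, exists2 e : R, 0 < e & P i e) -> exists2 e : R, 0 < e & forall i, P i e.
Proof.
move=> mono ex.
have /fin_all_exists[f hf] : forall i, exists e : R, 0 < e /\ P i e.
  by move=> i; have [e] := ex i; exists e.
have pos : 0 < \big[Num.min/1]_i f i.
  by apply: lt_bigmin => // i _; exact: (hf i).1.
exists (\big[Num.min/1]_i f i) => // i.
by apply: mono (hf i).2 => //; apply: bigmin_le.
Qed.

End Perturbation.

Section SamePosition.
Context {R : realType} {n : nat}.
Implicit Types (x y w : 'rV[R]_n.+1) (r : R).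

Definition same_pos r x y : Prop := forall psi : aff_fun,
  (r < aff_eval psi x) = (r < aff_eval psi y) /\
  (aff_eval psi x < r) = (aff_eval psi y < r).

Lemma same_pos_sym r x y : same_pos r x y -> same_pos r y x.
Proof. by move=> h psi; have [-> ->] := h psi. Qed.

Lemma same_pos_eq r x y psi : same_pos r x y -> aff_eval psi x = r -> aff_eval psi y = r.
Proof.
move=> /(_ psi)[h1 h2] e; rewrite e ltxx in h1 h2.
by apply/eqP; rewrite eq_le !leNgt -h1 -h2.
Qed.

Lemma arrP r x i j : reflect (exists m, aff_eval (i, j, m) x = r) (arr r x i j).
Proof.
by apply: (iffP intrP) => -[m /= hm]; exists (- m) => /=; rewrite intrN; lra.
Qed.

Lemma perturb r x w : exists2 e : R, 0 < e & forall (s : R) (psi : aff_fun), 0 <= s -> s <= e ->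
  (r < aff_eval psi x -> r < aff_eval psi (x + s *: w)) /\
  (aff_eval psi x < r -> aff_eval psi (x + s *: w) < r).
Proof.
pose P (q : 'I_n.+1 * 'I_n.+1) (e : R) := forall (s : R) (m : int), 0 <= s -> s <= e ->
  (r < aff_eval (q.1, q.2, m) x -> r < aff_eval (q.1, q.2, m) (x + s *: w)) /\
  (aff_eval (q.1, q.2, m) x < r -> aff_eval (q.1, q.2, m) (x + s *: w) < r).
have [|[i j]|e e0 he] := @common_radius R _ P; last first.
- by exists e => // s [[i j] m] h1 h2; exact: (he (i, j) s m).
- have [dl dl0 hdl] := away_from_int (x 0 i - x 0 j - r).
  set c := w 0 i - w 0 j; have c1 : 0 < `|c| + 1 by rewrite ltr_wpDl.
  exists (dl / (`|c| + 1)); first by rewrite divr_gt0.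
  move=> s m s0; rewrite ler_pdivlMr // => se /=; rewrite !mxE.
  have sc : `|s * c| < dl.
    rewrite normrM (ger0_norm s0); have [->|sn] := eqVneq s 0; first by rewrite mul0r.
    have : 0 < s by rewrite lt_neqAle eq_sym sn.
    by lra.
  have [h1 h2] := hdl m; move: sc; rewrite ltr_norml => /andP[sc1 sc2].
  have e1 : x 0 i + s * w 0 i - (x 0 j + s * w 0 j) = x 0 i - x 0 j + s * c by rewrite /c; lra.
  rewrite e1; split => h.
    have /h1 : 0 < x 0 i - x 0 j - r + m%:~R by lra.
    lra.
  have /h2 : x 0 i - x 0 j - r + m%:~R < 0 by lra.
  lra.
- by move=> q e e' e0 le h s m s0 se; apply: h => //; apply: le_trans se le.
Qed.

(** The hyperplanes of level [r] through [x] contain the displaced point, and the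
    other ones stay away from [x] by [away_from_int]. *)
Lemma perturb_same_pos r x w : w \in facet_dir r x ->
  exists2 e : R, 0 < e & forall s : R, 0 <= s -> s <= e -> same_pos r x (x + s *: w).
Proof.
move=> /mem_facet_dir[_ hw]; have [e e0 he] := perturb r x w; exists e => // s s0 se psi.
have [h1 h2] := he s psi s0 se.
case: (ltgtP (aff_eval psi x) r) => h.
- by split; rewrite ?(h2 h) //; apply/esym/negbTE; rewrite -leNgt ltW // h2.
- by split; rewrite ?(h1 h) //; apply/esym/negbTE; rewrite -leNgt ltW // h1.
- have -> : aff_eval psi (x + s *: w) = r; last by rewrite ltxx.
  move: h; case: psi {h1 h2} => [[i j] m] h; have := hw i j.
  have -> : arr r x i j by apply/arrP; exists m.
  by move=> /(_ isT) e1; move: h; rewrite /= !mxE e1 => <-; lra.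
Qed.

End SamePosition.

Section Positions.
Context {R : realType} {k : fieldType} (K : local_field k) {n : nat}.
Implicit Types (x y w : 'rV[R]_n.+1) (r : R) (Z : 'M[k]_n.+1).

Lemma same_pos_glat r x y b Z : same_pos r x y -> glat K b x r Z -> glat K b y r Z.
Proof.
move=> h hZ i j; have := hZ i j; rewrite /depth; case: eqP => //= _.
have [h1 h2] := h (i, j, vl K (Z i j)); move: h1 h2 => /=.
case: b {hZ} => /= h1 h2; last first.
  move=> hlt; have : r < x 0 i - x 0 j + (vl K (Z i j))%:~R by lra.
  by rewrite h1; lra.
move=> hle; have : ~~ (x 0 i - x 0 j + (vl K (Z i j))%:~R < r) by rewrite -leNgt; lra.
by rewrite h2 -leNgt; lra.
Qed.

Lemma same_pos_lat r x y : same_pos r x y -> same_lat K x y 1%:M r.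
Proof.
move=> h b Z; rewrite Ad1; split; first exact: same_pos_glat.
exact/same_pos_glat/same_pos_sym.
Qed.

(** An elementary matrix of exact depth [r] at [x] must have exact depth [r] at
    [y]. *)
Lemma same_lat_dir r x y : apartment x -> apartment y -> same_lat K x y 1%:M r ->
  y - x \in facet_dir r x.
Proof.
move=> ax ay h; apply/mem_facet_dir; split.
  rewrite (eq_bigr (fun i => y 0 i - x 0 i)) => [|i _]; last by rewrite !mxE.
  by rewrite sumrB ax ay subrr.
move=> i j /(arr_elt K)[a a0 va].
have D z b : glat K b z r (a *: delta_mx i j) <-> depth K b (r + (z 0 j - z 0 i)) a.
  split; last exact: glat_delta.
  by move=> /(_ i j); rewrite !mxE !eqxx mulr1.
have : depth K true (r + (y 0 j - y 0 i)) a.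
  by apply/D; rewrite -[_ *: _]Ad1; apply/h/D; rewrite -va; exact: dep_vl.
have : ~ depth K false (r + (y 0 j - y 0 i)) a.
  move/D; rewrite -[_ *: _]Ad1 => /h/D; rewrite -va => h'.
  by have := dep_vlF (R := R) K a0; rewrite h'.
rewrite /depth (negbTE a0) /= va => /negP; rewrite -leNgt !mxE; lra.
Qed.

End Positions.

(** * Facets and traces of generalized facets *)

Section Facets.
Context {R : realType} {n : nat}.
Implicit Types (x y w : 'rV[R]_n.+1) (r : R) (F : set 'rV[R]_n.+1).

Lemma apartment_dir x w r : apartment x -> w \in facet_dir r x -> apartment (x + w).
Proof.
move=> ax /mem_facet_dir[h _]; rewrite /apartment /= in ax *.
rewrite (eq_bigr (fun i => x 0 i + w 0 i)) => [|i _]; last by rewrite mxE.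
by rewrite big_split /= ax h addr0.
Qed.

Lemma aff_eval_continuous (psi : aff_fun) : continuous (fun x : 'rV[R]_n.+1 => aff_eval psi x).
Proof.
case: psi => [[i j] m] x.
have c (l : 'I_n.+1) : {for x, continuous (fun y : 'rV[R]_n.+1 => y 0 l)} by exact: coord_continuous.
change {for x, continuous (fun y : 'rV[R]_n.+1 => y 0 i - y 0 j + m%:~R)}.
apply: continuousD; last exact: cst_continuous.
by apply: continuousB; exact: c.
Qed.

Lemma facetP r F x : facet r F -> F x -> exists Sigma : set aff_fun,
  [/\ Sigma `<=` aff_root, facet_stratum r Sigma x
    & F = connected_component (facet_stratum r Sigma) x].
Proof.
move=> [Sg [_ Sr [x0 sx0 ->]]] cx; exists Sg; split => //.
  exact: connected_component_sub cx.
exact: same_connected_component.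
Qed.

Lemma facet_apartment r F x : facet r F -> F x -> apartment x.
Proof. by move=> fF Fx; have [Sg [_ [[]]]] := facetP fF Fx. Qed.

(** On the connected set [F], an affine root outside [Sigma] is continuous and
    avoids the value [r]. *)
Lemma facet_same_pos r F x y : facet r F -> F x -> F y -> same_pos r x y.
Proof.
move=> fF Fx Fy; have [Sg [Sr sx eF]] := facetP fF Fx.
suff main u v psi : F u -> F v ->
    (r < aff_eval psi u -> r < aff_eval psi v) /\ (aff_eval psi u < r -> aff_eval psi v < r).
  by move=> psi; have [a1 a2] := main x y psi Fx Fy; have [b1 b2] := main y x psi Fy Fx;
    split; apply/idP/idP.
move=> Fu Fv; have FS : F `<=` facet_stratum r Sg by rewrite eF; exact: connected_component_sub.
have [root|nroot] := pselect (aff_root psi); last first.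
  case: psi nroot => [[i j] m]; rewrite /aff_root /= => /negP/negPn/eqP ->.
  by rewrite !subrr.
have [SP|nSP] := pselect (Sg psi).
  have [[_ hu] _] := FS _ Fu; have [[_ hv] _] := FS _ Fv.
  by have [_ ->] := hu _ SP; have [_ ->] := hv _ SP.
have ne z : F z -> aff_eval psi z <> r.
  move=> /FS[[az _] hz] e; apply: hz; exists psi; first by split.
  by split.
have cI : connected ((fun z => aff_eval psi z) @` F).
  apply: connected_continuous_connected; first by rewrite eF; exact: component_connected.
  exact/continuous_subspaceT/aff_eval_continuous.
have /connected_intervalP iI := cI.
have noncross a b : F a -> F b -> aff_eval psi a < r -> r < aff_eval psi b -> False.
  move=> Fa Fb la lb; have [|||z Fz ez] := iI (aff_eval psi a) (aff_eval psi b) _ _ r.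
  - by exists a.
  - by exists b.
  - by rewrite !ltW.
  - exact: ne Fz ez.
split=> hu; case: (ltgtP (aff_eval psi v) r) => // hv.
- by case: (noncross v u).
- by case: (ne v Fv).
- by case: (noncross u v).
- by case: (ne v Fv).
Qed.

Lemma facet_dim r F x : facet r F -> F x -> (aff_dim F).+1 = ncomp r x.
Proof.
move=> fF Fx; rewrite -dim_facet_dir; congr _.+1.
have ax := facet_apartment fF Fx; have [Sg [Sr sx eF]] := facetP fF Fx.
apply: (@aff_dimE _ _ _ x) => //.
- move=> y Fy; have sp := facet_same_pos fF Fx Fy.
  apply/mem_facet_dir; split.
    rewrite (eq_bigr (fun i => y 0 i - x 0 i)) => [|i _]; last by rewrite !mxE.
    by rewrite sumrB ax (facet_apartment fF Fy) subrr.
  move=> i j /arrP[m hm]; have := same_pos_eq sp hm; move: hm; rewrite /= !mxE; lra.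
- by move=> z hz; rewrite -(subrK x z) addrC; apply: apartment_dir hz.
- move=> w hw; have [e e0 he] := perturb_same_pos hw.
  exists e; first exact: lt0r_neq0.
  rewrite eF; pose B := (fun s : R => x + s *: w) @` `[0, e].
  suff : B `<=` connected_component (facet_stratum r Sg) x.
    by apply; exists e => //=; rewrite in_itv /= lexx ltW.
  apply: connected_component_max.
  + by exists 0; rewrite ?scale0r ?addr0 //= in_itv /= lexx ltW.
  + move=> _ [s /= + <-]; rewrite in_itv /= => /andP[s0 se].
    have sp := he s s0 se; have [[_ hS] hN] := sx.
    have axs : apartment (x + s *: w) by apply: apartment_dir ax _; exact: memvZ hw.
    split; first by split => // psi SP; split => //; apply: same_pos_eq sp (hS _ SP).2.
    move=> [psi hpsi [_ ev]]; apply: hN; exists psi => //; split => //.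
    exact: same_pos_eq (same_pos_sym sp) ev.
  + apply: connected_continuous_connected; first exact: segment_connected.
    apply: continuous_subspaceT => s; apply: cvgD; first exact: cvg_cst.
    by apply: cvgZr_tmp; exact: cvg_id.
Qed.

(** At most one affine root for each gradient takes the value [r] at [x], which
    makes [Sigma] finite. *)
Lemma facet_ex r x : apartment x -> exists Sigma : set aff_fun,
  [/\ finite_set Sigma, Sigma `<=` aff_root, facet_stratum r Sigma x
    & forall psi, aff_root psi -> aff_eval psi x = r -> Sigma psi].
Proof.
move=> ax; exists [set psi | aff_root psi /\ aff_eval psi x = r]; split.
- pose f (q : 'I_n.+1 * 'I_n.+1) : aff_fun := (q.1, q.2, Num.floor (r - (x 0 q.1 - x 0 q.2))).
  apply: (@sub_finite_set _ _ (f @` setT)); last exact/finite_image/finite_finset.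
  move=> [[i j] m] [_ /= e]; exists (i, j) => //; rewrite /f /=; congr (_, _).
  by rewrite -e addrAC subrr add0r intrKfloor.
- by move=> psi [].
- split; first by split => // psi [_ h].
  by move=> [psi [h1 h2] [_ h3]]; apply: h2.
- by move=> psi.
Qed.

End Facets.

Section Traces.
Context {R : realType} {k : fieldType} (K : local_field k) {n : nat}.
Hypothesis n_unit : int_unit (R := R) K (n.+1%:R : k).
Implicit Types (x y : 'rV[R]_n.+1) (r : R) (g h X Z : 'M[k]_n.+1).

(** As [n + 1] is invertible, [gl] is the sum of [sl] and the scalars,
    compatibly with the filtrations. *)
Lemma glat_filt b x r Z : glat K b x r Z ->
  exists2 c, depth (R := R) K b r c & filt K b x r (Z - c%:M).
Proof.
move=> hZ; have hc : depth (R := R) K b r (\tr Z / n.+1%:R).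
  rewrite -[r]addr0 -[b]andbT; apply: depM; first exact: glat_trace hZ.
  exact/int_unit_dep/int_unitV.
exists (\tr Z / n.+1%:R) => //; apply/filt_glat; split.
  rewrite raddfB /= mxtrace_scalar -[X in _ - X]mulr_natr divfK ?subrr //.
  exact: int_unit_neq0 n_unit.
by apply: glatB hZ _; apply: glat_scalar.
Qed.

Lemma bfilt_same_lat g h x y r : SL g -> SL h -> apartment x -> apartment y ->
  (forall b, bfilt K b (bpt K g x) r = bfilt K b (bpt K h y) r) ->
  same_lat K x y (invmx h *m g) r.
Proof.
move=> sg sh ax ay e; have [ug uh] := (SL_unitmx sg, SL_unitmx sh).
have main g' h' x' y' b Z : SL g' -> SL h' -> apartment x' -> apartment y' ->
    bfilt K b (bpt K g' x') r = bfilt K b (bpt K h' y') r ->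
    glat K b x' r Z -> glat K b y' r (Ad (invmx h' *m g') Z).
  move=> sg' sh' ax' ay' e' /glat_filt[c hc hZ].
  have [ug' uh'] := (SL_unitmx sg', SL_unitmx sh').
  have : bfilt K b (bpt K h' y') r (Ad g' (Z - c%:M)).
    by rewrite -e'; apply/bfilt_bpt => //; rewrite AdK.
  move=> /(bfilt_bpt _ _ _ _ sh' ay')/filt_glat[_]; rewrite -AdM ?unitmx_inv // AdB.
  by rewrite Ad_scalar ?unitmx_mul ?unitmx_inv ?uh' // => /glat_diff; apply; exact: glat_scalar.
move=> b Z; split; first exact: main.
move=> /(main h g y x b _ sh sg ay ax (esym (e b))).
by rewrite -AdM ?unitmx_mul ?unitmx_inv ?ug ?uh // mulmxA mulmxK // mulVmx // Ad1.
Qed.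

Lemma same_pos_bfilt b g x y r : SL g -> apartment x -> apartment y -> same_pos r x y ->
  bfilt K b (bpt K g x) r = bfilt K b (bpt K g y) r.
Proof.
move=> sg ax ay sp; apply/seteqP; split=> X /(bfilt_bpt _ _ _ _ sg) h; apply/bfilt_bpt => //.
  by apply/filt_glat; have /filt_glat[h1 h2] := h ax; split => //; apply: same_pos_glat sp h2.
apply/filt_glat; have /filt_glat[h1 h2] := h ay; split => //.
exact: same_pos_glat (same_pos_sym sp) h2.
Qed.

(** The trace lies in [y + facet_dir r y] by [same_lat_dir], and contains all points
    of this space close enough to [y] by [perturb_same_pos]. *)
Lemma trace_dim r z g y : SL g -> apartment y -> gfacet K r z (bpt K g y) ->
  (aff_dim (apt_trace K g (gfacet K r z))).+1 = ncomp r y.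
Proof.
move=> sg ay [_ e1 e2]; have ug := SL_unitmx sg.
have e b : bfilt K b z r = bfilt K b (bpt K g y) r by case: b.
rewrite -dim_facet_dir; congr _.+1; apply: (@aff_dimE _ _ _ y).
- by split => //; split => //; exact: bpt_building.
- move=> y' [ay' [_ e1' e2']]; apply: (same_lat_dir (K := K)) => //.
  have e' b : bfilt K b z r = bfilt K b (bpt K g y') r by case: b.
  by rewrite -(mulVmx ug); apply: bfilt_same_lat => // b; rewrite -e -e'.
- by move=> u hu; rewrite -(subrK y u) addrC; apply: apartment_dir hu.
- move=> w hw; have [ep e0 he] := perturb_same_pos hw; exists ep; first exact: lt0r_neq0.
  have aw : apartment (y + ep *: w) by apply: apartment_dir ay _; exact: memvZ hw.
  have sp : same_pos r y (y + ep *: w) by apply: he; rewrite ?lexx // ltW.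
  split => //; split; first exact: bpt_building.
    by rewrite e; exact: same_pos_bfilt.
  by rewrite e; exact: same_pos_bfilt.
Qed.

(** Nothing is known about the apartment in which the dimension is computed; the
    point [y] records it. *)
Lemma gfacet_dimE r z : building K z -> exists g y,
  [/\ SL g, apartment y, gfacet K r z (bpt K g y) & (gfacet_dim K (gfacet K r z)).+1 = ncomp r y].
Proof.
move=> [g0 [y0 [sg0 ay0 ez]]]; rewrite /gfacet_dim; set D := [set d | _].
have : D (xget 0%N D).
  apply: xgetPex; exists (aff_dim (apt_trace K g0 (gfacet K r z))); exists g0 => //; split => //.
  by exists y0; split => //; split; rewrite -?ez //; exists g0, y0.
move=> [g sg [[y [ay hy]] ->]]; exists g, y; split => //.
exact: trace_dim.
Qed.

End Traces.

(** * Blocks of a partition and generic points *)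

Section Partition.
Variables (n : nat) (la : seq nat).
Hypothesis la_part : is_partition n.+1 la.

Definition blk (i : 'I_n.+1) : nat := reshape_index la i.
Definition boff (i : 'I_n.+1) : nat := reshape_offset la i.
Definition bsize (i : 'I_n.+1) : nat := nth 0%N la (blk i).
Definition bnxt : rel 'I_n.+1 := fun i j => (j == i.+1 :> nat) && (blk i == blk j).

Let la_sum : sumn la = n.+1. Proof. by case: la_part. Qed.
Let la_pos m : (m < size la)%N -> (0 < nth 0%N la m)%N.
Proof. by case: la_part => _ /allP h _ hm; apply: h; apply: mem_nth. Qed.
Let ord_sum (i : 'I_n.+1) : (i < sumn la)%N. Proof. by rewrite la_sum. Qed.

Lemma blkE (i : 'I_n.+1) : i = (sumn (take (blk i) la) + boff i)%N :> nat.
Proof. by rewrite -[LHS](reshape_indexK la). Qed.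

Lemma blk_inj i j : blk i = blk j -> boff i = boff j -> i = j.
Proof. by move=> e1 e2; apply: val_inj; rewrite /= (blkE i) (blkE j) e1 e2. Qed.

Lemma boff_lt i : (boff i < bsize i)%N.
Proof. exact: reshape_offsetP (ord_sum i). Qed.

Lemma blk_lt i : (blk i < size la)%N.
Proof. exact: reshape_indexP (ord_sum i). Qed.

Lemma blk_flatten (j : 'I_n.+1) r c : (c < nth 0%N la r)%N -> j = (sumn (take r la) + c)%N :> nat ->
  blk j = r /\ boff j = c.
Proof.
move=> hc e; rewrite /blk /boff e -/(flatten_index la r c).
by rewrite flatten_indexKl // flatten_indexKr.
Qed.

Lemma bnxtS i j : bnxt i j -> j = i.+1 :> nat.
Proof. by case/andP => /eqP. Qed.

Lemma bnxt_size i j : bnxt i j -> bsize i = bsize j.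
Proof. by case/andP => _ /eqP e; rewrite /bsize e. Qed.

Lemma boff_nxt i j : bnxt i j -> boff j = (boff i).+1.
Proof.
case/andP => /eqP e1 /eqP e2; have := blkE i; have := blkE j; rewrite e1 e2; lia.
Qed.

Lemma boff0 j : (forall i, ~~ bnxt i j) -> boff j = 0%N.
Proof.
move=> h; case e : (boff j) => [//|c]; exfalso.
have cj : (c < nth 0%N la (blk j))%N by have := boff_lt j; rewrite e /bsize; lia.
have ij : j = (sumn (take (blk j) la) + c).+1 :> nat by rewrite [LHS](blkE j) e addnS.
have lt : (sumn (take (blk j) la) + c < n.+1)%N by have := ltn_ord j; rewrite {1}ij; lia.
have [e1 e2] := blk_flatten (j := Ordinal lt) cj erefl.
by have := h (Ordinal lt); rewrite /bnxt /= e1 eqxx andbT -ij eqxx.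
Qed.

Lemma bsize_end i : (forall j, ~~ bnxt i j) -> bsize i = (boff i).+1.
Proof.
move=> h; apply/eqP; rewrite eqn_leq boff_lt andbT leqNgt; apply/negP => lt.
have := flatten_indexP lt; rewrite /flatten_index la_sum addnS -blkE => lt'.
have e0 : i.+1 = (sumn (take (blk i) la) + (boff i).+1)%N by rewrite addnS -blkE.
have [e1 e2] := blk_flatten (j := Ordinal lt') lt e0.
by have := h (Ordinal lt'); rewrite /bnxt /= e1 !eqxx.
Qed.

Lemma I_partE (i j : 'I_n.+1) : j = i.+1 :> nat -> I_part n.+1 la i.+1 <-> bnxt i j.
Proof.
move=> ij; split; last first.
  move=> hn; split=> // m /andP[m1 m2] e; have := boff_nxt hn.
  have [lt|ge] := ltnP m (size la); last first.
    by move: e; rewrite take_oversize // la_sum -ij; have := ltn_ord j; lia.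
  have [|_ ->] := blk_flatten (j := j) (la_pos lt); last by [].
  by rewrite addn0 -e.
move=> [_ _ h]; apply/negPn/negP => hn.
have e : bsize i = (boff i).+1.
  apply: bsize_end => j'; apply: contraNN hn => hj.
  by rewrite (_ : j = j') //; apply: val_inj; rewrite /= ij (bnxtS hj).
apply: (h (blk i).+1); first by rewrite blk_lt.
rewrite (take_nth 0%N (blk_lt i)) sumn_rcons -/(bsize i) e addnS; congr _.+1; exact: blkE.
Qed.

Lemma jordan_mxE (k : fieldType) (d : 'rV[k]_n.+1) : jordan_mx k n.+1 la *m diag_mx d =
  \matrix_(i, j) ((bnxt i j)%:R * d 0 j).
Proof. by apply/matrixP => i j; rewrite mul_mx_diag !mxE. Qed.

End Partition.

Section GenericPoint.
Context {R : realType} {k : fieldType} (K : local_field k) {n : nat}.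
Variables (la : seq nat) (la_part : is_partition n.+1 la) (d : 'rV[k]_n.+1) (r : R).
Local Notation nxt := (bnxt (n := n) la).

Lemma H_partP (x : 'rV[R]_n.+1) : H_part K r la d x <->
  apartment x /\ forall i j, nxt i j -> x 0 i - x 0 j + (vl K (d 0 j))%:~R = r.
Proof.
split=> -[ax h]; split=> //.
  move=> i j hij; have ij := bnxtS hij.
  by have [] := h (i, j, vl K (d 0 j)); first by exists i, j; split => //; apply/(I_partE la_part ij).
move=> _ [i [j [ij /(I_partE la_part ij) hij ->]]]; split => //.
exact: h.
Qed.

(** The first indices of the blocks, one for each part. *)
Definition starts : {set 'I_n.+1} := [set: 'I_n.+1] :\: [set j | [exists i, nxt i j]].

Lemma starts_off i : i \in starts -> boff la i = 0%N.
Proof.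
rewrite !inE andbT => /existsPn h; exact: (boff0 la_part).
Qed.

Lemma starts_ncomp (x : 'rV[R]_n.+1) : (forall i j, arr r x i j -> blk la i = blk la j) ->
  (#|starts| <= ncomp r x)%N.
Proof.
move=> h; have hc i j : component r x i = component r x j -> blk la i = blk la j.
  move/eqP; rewrite componentE => /connectP[l + ->]; elim: l i => [|a l IH] i //= /andP[hia /IH <-].
  by case/orP: hia => /h.
rewrite -(card_in_imset (f := component r x) (D := mem starts)).
  apply: subset_leq_card; apply/fintype.subsetP => _ /imsetP[i _ ->]; exact: comp_comps.
move=> i j si sj /hc e; apply: (blk_inj e).
by rewrite !starts_off.
Qed.

(** A generic point of [H_part]: shifting the blocks by distinct small amounts
    leaves no affine root of level [r] between different blocks. *)
Lemma generic_point x0 : H_part K r la d x0 -> exists2 x : 'rV[R]_n.+1, H_part K r la d x &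
  forall i j, arr r x i j -> blk la i = blk la j.
Proof.
move=> /H_partP[a0 h0]; pose mean : R := (\sum_(i < n.+1) (blk la i)%:R) / n.+1%:R.
pose w : 'rV[R]_n.+1 := \row_i ((blk (n := n) la i)%:R - mean).
have [e e0 he] := perturb r x0 w; exists (x0 + e *: w).
  apply/H_partP; split.
    rewrite /apartment /= (eq_bigr (fun i => x0 0 i + e * w 0 i)) => [|i _]; last by rewrite !mxE.
    rewrite big_split /= a0 add0r -mulr_sumr
      (eq_bigr (fun i => (blk la i)%:R - mean)) => [|i _]; last by rewrite mxE.
    have mE : mean *+ n.+1 = \sum_(i < n.+1) (blk la i)%:R.
      by rewrite -[LHS]mulr_natr divfK // pnatr_eq0.
    by rewrite sumrB sumr_const card_ord mE subrr mulr0.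
  move=> i j hij; rewrite !mxE; have /andP[_ /eqP ->] := hij.
  by rewrite -(h0 _ _ hij); lra.
move=> i j /arrP[m hm]; have [h1 h2] := he e (i, j, m) (ltW e0) (lexx _).
have hm0 : aff_eval (i, j, m) x0 = r.
  case: (ltgtP (aff_eval (i, j, m) x0) r) => // h.
    by have := h2 h; rewrite hm ltxx.
  by have := h1 h; rewrite hm ltxx.
move: hm hm0; rewrite /= !mxE => hm hm0.
have : e * ((blk la i)%:R - (blk la j)%:R) = 0 by lra.
by move/eqP; rewrite mulf_eq0 gt_eqF //= subr_eq0 eqr_nat => /eqP.
Qed.

(** The facet through a generic point lies in [H_part] and has at least one
    component for each block. *)
Lemma maximal_ncomp F (x : 'rV[R]_n.+1) : maximal_facet_in r (H_part K r la d) F -> F x ->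
  (#|starts| <= ncomp r x)%N.
Proof.
move=> [fF FH hmax] Fx; have [x' Hx' gx'] := generic_point (FH _ Fx).
apply: leq_trans (starts_ncomp gx') _.
have [ax' hx'] := (H_partP x').1 Hx'.
have [Sg [Sf Sr sx hS]] := facet_ex r ax'.
pose F' := connected_component (facet_stratum r Sg) x'.
have fF' : facet r F' by exists Sg; split => //; exists x'.
have F'x' : F' x' by exact: connected_component_refl.
rewrite -(facet_dim fF' F'x') -(facet_dim fF Fx) ltnS; apply: hmax => // y.
move=> /connected_component_sub[[ay hy] _]; apply/H_partP; split => // i j hij.
have [|_] := hy (i, j, vl K (d 0 j)); last by [].
apply: hS; last exact: hx'.
by rewrite /aff_root /= -val_eqE /= (bnxtS hij) neq_ltn leqnn.
Qed.

End GenericPoint.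

(** * Lifts, distinguished pairs and orbits *)

Section Cosets.
Context {R : realType} {k : fieldType} (K : local_field k) {n : nat}.
Implicit Types (x y : 'rV[R]_n) (r s t : R) (A B X Y Z H : 'M[k]_n).

Lemma filtD b x r X Y : filt K b x r X -> filt K b x r Y -> filt K b x r (X + Y).
Proof.
move=> /filt_glat[t1 h1] /filt_glat[t2 h2]; apply/filt_glat; split; last exact: glatD.
by rewrite raddfD /= t1 t2 addr0.
Qed.

Lemma filtN b x r X : filt K b x r X -> filt K b x r (- X).
Proof.
by move=> /filt_glat[t1 h1]; apply/filt_glat; split; [rewrite raddfN /= t1 oppr0|exact: glatN].
Qed.

Lemma filt0 b x r : filt K b x r 0.
Proof. by apply/filt_glat; split; [exact: raddf0|exact: glat0]. Qed.

Lemma mem_img x r X : img K x r X X.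
Proof. by rewrite /img /= subrr; exact: filt0. Qed.

Lemma lie_tr A B : \tr (lie A B) = 0.
Proof. by rewrite /lie raddfB /= mxtrace_mulC subrr. Qed.

Lemma img_ge x r A X : mp K x r X -> img K x r X A -> mp K x r A.
Proof.
move=> hX hA; rewrite -(subrK X A); apply: filtD hX.
by move: hA => /filt_glat[h1 h2]; apply/filt_glat; split => //; exact: glat_ge h2.
Qed.

(** The bracket of cosets is well defined because the commutator adds depths. *)
Lemma Vbracket_img x s t A0 B0 : mp K x s A0 -> mp K x t B0 ->
  Vbracket K x s t (img K x s A0) (img K x t B0) = img K x (s + t) (lie A0 B0).
Proof.
move=> hA0 hB0; have key A B : img K x s A0 A -> img K x t B0 B ->
    mp_plus K x (s + t) (lie A B - lie A0 B0).
  move=> hA hB; have /filt_glat[_ gB] := img_ge hB0 hB.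
  have /filt_glat[_ gA0] := hA0.
  move: hA hB => /filt_glat[_ gA] /filt_glat[_ gB'].
  apply/filt_glat; split; first by rewrite raddfB /= !lie_tr subrr.
  have -> : lie A B - lie A0 B0 = lie (A - A0) B + lie A0 (B - B0).
    rewrite /lie !mulmxBl !mulmxBr !opprB.
    move: (A *m B) (B *m A) (A0 *m B) (B *m A0) (A0 *m B0) (B0 *m A0) => a b c d e f.
    by apply/matrixP => i j; rewrite !mxE; ring.
  by apply: glatD; [exact: (glat_lie gA gB)|exact: (glat_lie gA0 gB')].
apply/seteqP; split=> Z.
  move=> [A [B [hA hB hZ]]]; rewrite /img /=.
  have -> : Z - lie A0 B0 = (Z - lie A B) + (lie A B - lie A0 B0) by rewrite addrA subrK.
  by apply: filtD => //; apply: key.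
by move=> hZ; exists A0, B0; split => //; exact: mem_img.
Qed.

Lemma Vscale_img x r c A0 : Vscale K x r c (img K x r A0) = img K x r (A0 *~ c).
Proof.
have scale A : mp_plus K x r A -> mp_plus K x r (A *~ c).
  move=> hA; suff nat m : mp_plus K x r (A *+ m).
    by case: c => m; [exact: nat|rewrite NegzE mulrNz; apply/filtN/nat].
  by elim: m => [|m IH]; [exact: filt0|rewrite mulrS; apply: filtD].
apply/seteqP; split=> Z.
  move=> [A hA hZ]; rewrite /img /=.
  have -> : Z - A0 *~ c = (Z - A *~ c) + (A - A0) *~ c by rewrite mulrzBl addrA subrK.
  by apply: filtD => //; apply: scale.
by move=> hZ; exists A0 => //; exact: mem_img.
Qed.

Lemma Vlie_triple_img x r Y H X : lie_triple Y H X ->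
  mp K x (- r) Y -> mp K x 0 H -> mp K x r X ->
  Vlie_triple K x r (img K x (- r) Y) (img K x 0 H) (img K x r X).
Proof.
move=> [h1 h2 h3] hY hH hX; split; first by split; [exists Y|exists H|exists X].
rewrite !Vbracket_img // !Vscale_img !add0r subrr h1 h2 h3; split => //.
Qed.

End Cosets.

Section Main.
Context {R : realType} {k : fieldType} (K : local_field k) {n : nat}.
Variables (p : nat) (char_p : p \in [pchar (residue K)]).
Hypotheses (n_lt_p : (n.+1 < p)%N) (p_gt2 : (2 < p)%N).
Variables (r : R) (la : seq nat) (la_part : is_partition n.+1 la).
Variables (d : 'rV[k]_n.+1) (D_torus : SL (diag_mx d)).
Variables (F : set 'rV[R]_n.+1) (F_max : maximal_facet_in r (H_part K r la d) F).

Let X0 : 'M[k]_n.+1 := jordan_mx k n.+1 la *m diag_mx d.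
Let x := facet_pt F.

Let fF : facet r F. Proof. by case: F_max. Qed.

Let Fx : F x.
Proof.
have [Sg [_ _ [x0 sx0 eF]]] := fF; apply: (xgetPex 0); exists x0.
by rewrite eF; exact: connected_component_refl.
Qed.

Let hx : H_part K r la d x.
Proof. by case: F_max => _ FH _; exact: FH. Qed.

Let ax : apartment x.
Proof. exact: facet_apartment fF Fx. Qed.

Let d0 i : d 0 i != 0.
Proof.
apply/eqP => e; move: D_torus; rewrite /SL /= det_diag (bigD1 i) //= e mul0r => /eqP.
by rewrite eq_sym oner_eq0.
Qed.

Let X0E : X0 = \matrix_(i, j) ((bnxt la i j)%:R * d 0 j).
Proof. exact: jordan_mxE. Qed.

Let unit2 : 2%:R != 0 :> k.
Proof. exact: (small_nat_neq0 (R := R) char_p). Qed.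

Let n_unit : int_unit (R := R) K (n.+1%:R : k).
Proof. by apply: (int_unit_nat char_p); rewrite n_lt_p. Qed.

Let triple_tr0 (Y H X : 'M[k]_n.+1) : lie_triple Y H X -> [/\ \tr Y = 0, \tr H = 0 & \tr X = 0 :> k].
Proof.
have two (t : k) : t *+ 2 = 0 -> t = 0.
  by move=> /eqP; rewrite -mulr_natr mulf_eq0 (negbTE unit2) orbF => /eqP.
move=> [h1 h2 h3]; split; last 2 first.
- by rewrite -h3 lie_tr.
- by apply: two; rewrite -raddfMn /= -h1 lie_tr.
apply: two; have : - \tr (Y *+ 2) = 0 by rewrite -raddfN /= -h2 lie_tr.
by rewrite raddfMn /= => /eqP; rewrite oppr_eq0 => /eqP.
Qed.

Let triple_mp (y : 'rV[R]_n.+1) (s : R) (Y H X : 'M[k]_n.+1) : lie_triple Y H X ->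
  [/\ glat K true y s Y -> mp K y s Y,
  glat K true y s H -> mp K y s H & glat K true y s X -> mp K y s X].
Proof. by move=> /triple_tr0[h1 h2 h3]; split => h; apply/filt_glat. Qed.

Let std_triple : exists Y H, [/\ lie_triple Y H X0, mp K x (- r) Y, mp K x 0 H & mp K x r X0].
Proof.
have [_ hxx] := (H_partP K la_part d r x).1 hx.
have [Y [H []]] := block_triple (@bnxtS _ la) (boff_nxt la_part) (boff0 la_part)
  d0 hxx (@bnxt_size _ la) (bsize_end la_part).
rewrite -X0E => tr gY gH; exists Y, H.
have gX : glat K true x r X0 by rewrite X0E; exact: block_glat hxx.
by split => //; [case: (triple_mp x (- r) tr)|case: (triple_mp x 0 tr)|case: (triple_mp x r tr)];
  move=> h1 h2 h3; [exact: h1|exact: h2|exact: h3].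
Qed.

Let v := img_F K r F X0.

Let same_x x1 : F x1 -> same_pos r x1 x.
Proof. by move=> Fx1; apply: facet_same_pos fF Fx1 Fx. Qed.

(** The lattices of depth [r] and [- r] are constant on [F], so every lift can be
    moved to the chosen point [x]. *)
Let lift_at x1 Y H X : F x1 -> lift_triple K x1 r v Y H X ->
  [/\ lie_triple Y H X, mp K x (- r) Y, mp K x r X & glat K false x r (X - X0)].
Proof.
move=> Fx1 [[ev [-> -> ->]]|[_ tr [hY _ hX] [w [h [_ _ _ ev]]]]].
  split; [by split; rewrite /lie ?mulmx0 ?mul0mx subrr ?mul0rn ?oppr0|exact: filt0|exact: filt0|].
  have : v 0 by rewrite ev; exact: mem_img.
  by move=> /filt_glat[].
have sp := same_x Fx1; have sl := same_pos_lat K sp.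
have sl' := same_lat_dual (unitmx1 _ _) sl.
split => //.
- have /filt_glat[t0 g0] := hY; apply/filt_glat; split => //.
  by rewrite -[Y]Ad1; apply/sl'.
- have /filt_glat[t0 g0] := hX; apply/filt_glat; split => //.
  by rewrite -[X]Ad1; apply/sl.
- have : v X by rewrite ev; exact: mem_img.
  by move=> /filt_glat[].
Qed.

Let lift_orbit x1 Y H X : F x1 -> lift_triple K x1 r v Y H X -> exists2 g, SL g & X = Ad g X0.
Proof.
move=> Fx1 /(lift_at Fx1)[tr /filt_glat[_ gY] /filt_glat[_ gX] gXX].
have [S gS hS] := triple_pinv char_p n_lt_p p_gt2 tr gX gY.
have [Y0 [H0 [tr0 _ _ _]]] := std_triple.
have [_ hxx] := (H_partP K la_part d r x).1 hx.
rewrite X0E in gXX tr0.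
have Xn := triple_nilpotent (R := R) char_p n_lt_p p_gt2 tr.
have X0n := triple_nilpotent (R := R) char_p n_lt_p p_gt2 tr0.
have [g sg eX] := lift_conj char_p n_lt_p (@bnxtS _ la) (boff_nxt la_part) (boff0 la_part)
  d0 hxx Xn X0n gS hS gXX.
by exists g; rewrite // X0E.
Qed.

Let lift_ex : exists Y H X, lift_triple K x r v Y H X.
Proof.
have [e|ne] := pselect (v = img K x r 0).
  by exists 0, 0, 0; left; split.
have [Y [H [tr hY hH hX]]] := std_triple; exists Y, H, X0; right; split => //.
exists (img K x (- r) Y), (img K x 0 H); split => //.
exact: Vlie_triple_img.
Qed.

Let SL1n : SL (1%:M : 'M[k]_n.+1). Proof. exact: SL1. Qed.

(** Any generalized facet in [B_r] has at most as many components as there are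
    blocks, and that of [F] has at least as many, in whichever apartments the two
    dimensions are computed. *)
Let lift_max x1 Y H X : F x1 -> lift_triple K x1 r v Y H X -> max_in_Br K r F Y H X.
Proof.
move=> Fx1 hl; have [g0 sg0 eX] := lift_orbit Fx1 hl.
have [tr hY hX _] := lift_at Fx1 hl; split.
  move=> z [[g [y [sg ay ez]]] e1 e2]; split; first by exists g, y.
    rewrite ez; apply/bfilt_bpt => //.
    have e b : bfilt K b (bpt K 1%:M x) r = bfilt K b (bpt K g y) r by rewrite -ez; case: b.
    have := bfilt_same_lat n_unit SL1n sg ax ay e; rewrite mulmx1 => sl.
    have ug := SL_unitmx sg; have ugV : invmx g \in unitmx by rewrite unitmx_inv.
    have /filt_glat[t0 gY] := hY; apply/filt_glat; split; first by rewrite Ad_tr.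
    exact/(same_lat_dual ugV sl).
  rewrite -e1; apply/bfilt_bpt => //.
  by rewrite invmx1 Ad1.
move=> C [z bz ->] CB; have [g [y [sg ay hy ey]]] := gfacet_dimE n_unit r bz.
have [|h [y' [sh ay' hy' ey']]] := gfacet_dimE n_unit r (z := bpt K 1%:M x).
  exact: bpt_building.
rewrite -ltnS /facetB -/x ey ey'.
have [ug uh] := (SL_unitmx sg, SL_unitmx sh).
apply: (@leq_trans #|starts (n := n) la|).
  have [_ /(bfilt_bpt _ _ _ _ sg ay) fY /(bfilt_bpt _ _ _ _ sg ay) fX] := CB _ hy.
  have trg := Ad_lie_triple (g := invmx g) (_ : invmx g \in unitmx) tr.
  have := ncomp_rank char_p n_lt_p p_gt2 (trg _)
    ((filt_glat _ _ _ _ _).1 fX).2 ((filt_glat _ _ _ _ _).1 fY).2.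
  rewrite unitmx_inv => /(_ ug).
  have -> : \rank (Ad (invmx g) X) = \rank X0.
    have rk (u : 'M[k]_n.+1) Z : u \in unitmx -> \rank (Ad u Z) = \rank Z.
      move=> uu; rewrite /Ad mxrankMfree ?row_free_unit ?unitmx_inv //.
      by rewrite -mxrank_tr trmx_mul mxrankMfree ?row_free_unit ?unitmx_tr // mxrank_tr.
    by rewrite eX !rk // ?unitmx_inv // SL_unitmx.
  have := block_rank (@bnxtS _ la) d0; rewrite -X0E => h1 h2.
  by rewrite -(leq_add2r (\rank X0)); apply: leq_trans h2 h1.
apply: leq_trans (maximal_ncomp la_part F_max Fx) _.
have [_ e1 e2] := hy'.
have e b : bfilt K b (bpt K 1%:M x) r = bfilt K b (bpt K h y') r by case: b.
have := bfilt_same_lat n_unit SL1n sh ax ay' e; rewrite mulmx1 => sl.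
by apply: (ncomp_le char_p _ _ sl); [lia|rewrite unitmx_inv].
Qed.

Lemma jordan_facet_distinguished :
  [/\ g_F K r F X0, I_r_d K r (F, v) & orbit_of K r F v = Ad_orbit X0].
Proof.
have [Y0 [H0 [tr0 hY0 hH0 hX0]]] := std_triple.
split => //.
- split.
    split => //=; first by exists X0.
    exists X0; split => //; exists n.+1.
    exact: (triple_nilpotent (R := R) char_p n_lt_p p_gt2 tr0).
  split => /=.
    by have [Y [H [X h]]] := lift_ex; exists x, Y, H, X.
  by move=> x1 Y H X; exact: lift_max.
- apply/seteqP; split=> Z.
    move=> [x1 [Y [H [X [Fx1 hl]]]]]; have [g sg ->] := lift_orbit Fx1 hl.
    by rewrite Ad_orbit_eq.
  have [Y [H [X hl]]] := lift_ex; have [g sg eX] := lift_orbit Fx hl.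
  by move=> hZ; exists x, Y, H, X; split => //; rewrite eX Ad_orbit_eq.
Qed.

End Main.

Theorem theorem4p2 (R : realType) (k : fieldType) (K : local_field k) (n : nat)
    (n_ge2 : (2 <= n)%N)
    (p : nat) (char_p : p \in [pchar (residue K)])
    (p_large : (3 * (n - 1) < p)%N)
    (r : R) (la : seq nat) (la_part : is_partition n la)
    (d : 'rV[k]_n) (D_torus : SL (diag_mx d))
    (F : set 'rV[R]_n) (F_max : maximal_facet_in r (H_part K r la d) F) :
  let X : 'M[k]_n := jordan_mx k n la *m diag_mx d in
  let v := img_F K r F X in
  [/\ g_F K r F X, I_r_d K r (F, v) & orbit_of K r F v = Ad_orbit X].
Proof.
case: n n_ge2 p_large la_part d D_torus F F_max => [//|n] n2 pl lap d D F F_max.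
by apply: (jordan_facet_distinguished char_p) => //; lia.
Qed.
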